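(* Let $X \subseteq \mathbb{R}^n$ be a simple closed set such that for each $z \in \partial X$ there exists a closed uniformly polynomially cuspidal (UPC) set $X_z$ with $z \in X_z \subseteq X$. Then $$\mathscr{C}^\omega_{1}(X) \cap \mathcal{C}^\infty|_X = \mathcal{C}^\omega|_X.$$
   Context: Let $X \subseteq \mathbb{R}^n$ be nonempty; $X^\circ$ denotes its interior and $\partial X$ its boundary. Plots: for positive integers $m,d$, an $(m,d)$-plot in $X$ is the germ at $0$ of a polynomial map $p=(p_1,\ldots,p_n):\mathbb{R}^m\to\mathbb{R}^n$ of degree at most $d$ (i.e. $\max_i \deg p_i\le d$) such that $p(U)\subseteq X$ for some neighborhood $U$ of $0$ in $\mathbb{R}^m$. $\mathcal{P}_{m,d}(X)$ is the set of all $(m,d)$-plots in $X$. $\mathscr{C}^\omega_{m,d}(X)$ is the set of all functions $f:X\to\mathbb{R}$ (no continuity assumed) such that $f\circ p$ is a real analytic germ at $0\in\mathbb{R}^m$ for all $p\in\mathcal{P}_{m,d}(X)$. Moreover $\mathscr{C}^\omega_m(X):=\bigcap_{d=1}^\infty\mathscr{C}^\omega_{m,d}(X)$. For closed $X$, $\mathcal{C}^\omega|_X$ (resp. $\mathcal{C}^\infty|_X$) is the set of all functions $f:X\to\mathbb{R}$ for which there exist an open neighborhood $U$ of $X$ in $\mathbb{R}^n$ and a real analytic (resp. smooth, i.e. $C^\infty$) function $F:U\to\mathbb{R}$ with $F|_X=f$. UPC sets: a closed set $Y\subseteq\mathbb{R}^n$ is uniformly polynomially cuspidal (UPC) if there exist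 positive integers $m,D$ and a constant $M>0$ such that for each $x\in Y$ there is a polynomial curve $h_x:\mathbb{R}\to\mathbb{R}^n$ of degree at most $D$ with (1) $h_x(0)=x$, and (2) $\operatorname{dist}(h_x(t),\mathbb{R}^n\setminus Y)\ge M t^m$ for all $x\in Y$ and $t\in[0,1]$. $X$ is simple if each $x\in\partial X$ has a basis of neighborhoods $\mathscr{U}$ such that $U\cap X^\circ$ is connected for all $U\in\mathscr{U}$. *)

(* Defs.v *)
From HB Require Import structures.
From mathcomp Require Import all_boot all_order all_algebra finmap.
From mathcomp Require mpoly.
Import(canonicals, coercions) mpoly.
From mathcomp Require Import all_classical all_reals all_analysis.
From mathcomp.analysis.showcase Require summability.

Set Implicit Arguments.
Unset Strict Implicit.
Unset Printing Implicit Defensive.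

Import Order.TTheory GRing.Theory Num.Theory numFieldNormedType.Exports.

Local Open Scope classical_set_scope.
Local Open Scope ring_scope.

Section Defs.
Context {R : realType}.

(* [polymap p t] evaluates at t the polynomial map R^m -> R^n whose components
   are the p i. *)
Definition polymap (m n : nat) (p : 'I_n -> mpoly.mpoly m R) (t : 'rV[R]_m) :
  'rV[R]_n := \row_i mpoly.meval (t 0) (p i).

(* Polynomial germs are identified with the polynomials themselves;
   [msize q <= d.+1] says that q has degree at most d. *)
Definition plot (m d n : nat) (X : set 'rV[R]_n)
    (p : 'I_n -> mpoly.mpoly m R) : Prop :=
  (forall i, (mpoly.msize (p i) <= d.+1)%N) /\
  \forall t \near (0 : 'rV[R]_m), X (polymap p t).

(* F is near a the sum of a power series centred at a; the sum over all
   multi-indices is unconditional (limit along the finite sets of indices). *)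
Definition analytic_at (n : nat) (F : 'rV[R]_n -> R) (a : 'rV[R]_n) : Prop :=
  exists c : {ffun 'I_n -> nat} -> R,
    \forall x \near a,
      summability.partial_sum
        (fun k : {ffun 'I_n -> nat} =>
           c k * \prod_i ((x : 'rV[R]_n) 0 i - a 0 i) ^+ k i)
        @ summability.totally --> F x.

(* The composite of f : X -> R with a plot p is only defined near 0, hence the
   germ g: for t near 0 there is exactly one x : X with \val x = polymap p t. *)
Definition Comega_md (m d n : nat) (X : set 'rV[R]_n) : set (X -> R) :=
  [set f : X -> R | forall p : 'I_n -> mpoly.mpoly m R, plot d X p ->
    exists g : 'rV[R]_m -> R, analytic_at g 0 /\
      \forall t \near (0 : 'rV[R]_m),
        forall x : X, \val x = polymap p t -> g t = f x].

Definition Comega (m n : nat) (X : set 'rV[R]_n) : set (X -> R) :=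
  \bigcap_(d in [set d : nat | (0 < d)%N]) @Comega_md m d n X.

Definition analytic_on (n : nat) (U : set 'rV[R]_n) (F : 'rV[R]_n -> R) : Prop :=
  forall x, U x -> analytic_at F x.

Fixpoint partials (n : nat) (s : seq 'I_n) (F : 'rV[R]_n -> R) : 'rV[R]_n -> R :=
  if s is i :: s' then 'D_(delta_mx 0 i) (partials s' F) else F.

(* For U open: all iterated partial derivatives of F exist and are continuous
   on U; they only depend on the values of F in U. *)
Definition smooth_on (n : nat) (U : set 'rV[R]_n) (F : 'rV[R]_n -> R) : Prop :=
  forall (s : seq 'I_n) (x : 'rV[R]_n), U x ->
    {for x, continuous (partials s F)} /\
    forall i : 'I_n, derivable (partials s F) x (delta_mx 0 i).

Definition analytic_restr (n : nat) (X : set 'rV[R]_n) : set (X -> R) :=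
  [set f : X -> R | exists (U : set 'rV[R]_n) (F : 'rV[R]_n -> R),
    [/\ open U, X `<=` U, analytic_on U F & forall x : X, F (\val x) = f x]].

Definition smooth_restr (n : nat) (X : set 'rV[R]_n) : set (X -> R) :=
  [set f : X -> R | exists (U : set 'rV[R]_n) (F : 'rV[R]_n -> R),
    [/\ open U, X `<=` U, smooth_on U F & forall x : X, F (\val x) = f x]].

(* The norm of 'rV[R]_n in the library is the sup norm. *)
Definition eucl_dist (n : nat) (x y : 'rV[R]_n) : R :=
  Num.sqrt (\sum_i (x 0 i - y 0 i) ^+ 2).

(* The distance to the empty set is +oo. *)
Definition dist_set (n : nat) (x : 'rV[R]_n) (A : set 'rV[R]_n) : \bar R :=
  ereal_inf [set (eucl_dist x y)%:E | y in A].

Definition polycurve (n : nat) (h : 'I_n -> {poly R}) (t : R) : 'rV[R]_n :=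
  \row_i (h i).[t].

Definition UPC (n : nat) (Y : set 'rV[R]_n) : Prop :=
  closed Y /\
  exists (m D : nat) (M : R), [/\ (0 < m)%N, (0 < D)%N, 0 < M &
    forall x, Y x -> exists h : 'I_n -> {poly R},
      [/\ forall i, (size (h i) <= D.+1)%N,
          polycurve h 0 = x &
          forall t : R, 0 <= t <= 1 ->
            ((M * t ^+ m)%:E <= dist_set (polycurve h t) (~` Y))%E]].

Definition boundary (n : nat) (X : set 'rV[R]_n) : set 'rV[R]_n :=
  closure X `\` interior X.

Definition simple_set (n : nat) (X : set 'rV[R]_n) : Prop :=
  forall x, boundary X x -> exists B : set (set 'rV[R]_n),
    [/\ forall U, B U -> nbhs x U,
        forall V, nbhs x V -> exists2 U, B U & U `<=` V &
        forall U, B U -> connected (U `&` interior X)].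

End Defs.

Arguments Comega_md {R} m d {n} X.
Arguments Comega {R} m {n} X.
Arguments analytic_restr {R n} X.
Arguments smooth_restr {R n} X.

(* Main.v *)
Require Import Defs.
From HB Require Import structures.
From mathcomp Require Import all_boot all_order all_algebra finmap.
From mathcomp Require mpoly.
Import(canonicals, coercions) mpoly.
From mathcomp Require Import all_classical all_reals all_analysis.
From mathcomp.analysis.showcase Require summability.
From mathcomp Require Import ring lra zify.

Set Implicit Arguments.
Unset Strict Implicit.
Unset Printing Implicit Defensive.

Import Order.TTheory GRing.Theory Num.Theory numFieldNormedType.Exports.

Local Open Scope classical_set_scope.
Local Open Scope ring_scope.

Local Notation mnm := mpoly.multinom.
Local Notation mdeg := mpoly.mdeg.

(**
If [F] is analytic near [X], its restriction is smooth, and substituting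
polynomials into convergent power series keeps them convergent; this is the
inclusion from right to left ([analytic_smooth], [analytic_at_comp]).

Conversely, let [F] be smooth near [X] and analytic along every polynomial arc
in [X].  Each [z] in [X] is the tip of a cusp made of polynomial arcs: there
are a polynomial curve [H] with [H 0 = z], an exponent [m] and [M > 0] such
that all the arcs [t |-> H t + t ^+ m *: v] with [`|v| < M] lie in [X] for [t]
near [0], and in its interior for [t != 0].  At an interior point [H] is
constant.  At a boundary point [H] comes from the UPC set through [z],
reparametrised by [t ^+ 2] because an arc must stay in [X] on both sides of [0]
([cusp_interior], [cusp_UPC]).

The Taylor series of [F] at [z] converges ([taylor_geom_bounded]).  Composed
with the arc of parameter [v] it is the expansion of an analytic function of
[t], so its coefficient [q k v] at [t ^+ (m * k)] is at most [B ^+ k.+1] in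
absolute value, with [B] depending on [v].  Since [q k] is continuous in [v],
Baire's theorem makes [B] uniform on some ball ([baire_bound]).  As
[H t - z] vanishes at [0], the polynomial [q k] has degree at most [k], and its
part of degree [k] is exactly the homogeneous Taylor polynomial of [F] of
degree [k].  Finite differences isolate each coefficient of that part and
bound it by a [k]-th power ([fd_cusp], [taylor_coef_bound]).

Let [T] be the sum of this series.  Along every arc of the cusp, [F] and [T]
are analytic functions of [t] with the same Taylor coefficients at [0], so they
agree on a common interval ([cusp_agree]); for small [t > 0] the points of
these arcs fill an open set.  By the identity theorem along segments, the set
of interior points of [X] near which [F] and [T] agree is open and closed in
the connected set [W `&` interior X] provided by simplicity (by a ball when [z]
is interior), so it is all of it.
The interior of [X] accumulates at every point of [X], hence [F = T] on [X]
near [z] ([local_extension]).  Two such local extensions coincide where their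
quarter-balls meet, so they glue to one analytic function ([glue]).
*)

(** * Unconditional sums *)

Section Sums.
Context {R : realType}.

Definition sums (I : choiceType) (a : I -> R) (l : R) : Prop :=
  summability.partial_sum a @ summability.totally --> l.

Definition bounded_sums (I : choiceType) (a : I -> R) (M : R) : Prop :=
  forall J : {fset I}, \sum_(i <- J) `|a i| <= M.

Lemma partial_sumE (I : choiceType) (a : I -> R) (J : {fset I}) :
  summability.partial_sum a J = \sum_(i <- J) a i.
Proof. by rewrite /summability.partial_sum big_seq_fsetE. Qed.

Lemma sumsP (I : choiceType) (a : I -> R) (l : R) :
  sums a l <-> forall e, 0 < e -> exists J : {fset I}, forall L : {fset I},
    (J `<=` L)%fset -> `|l - \sum_(i <- L) a i| <= e.
Proof.
have PF := @summability.totally_filter I.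
split.
  move=> + e e0 => /cvgrPdist_le /(_ _ e0) [J _ HJ]; exists J => L JL.
  by rewrite -partial_sumE; apply: HJ.
move=> H; apply/cvgrPdist_le => e e0; have [J HJ] := H _ e0.
by exists J => // L /= JL; rewrite partial_sumE; apply: HJ.
Qed.

Lemma sums_uniq (I : choiceType) (a : I -> R) (l l' : R) :
  sums a l -> sums a l' -> l = l'.
Proof.
rewrite /sums => H H'; have PF := @summability.totally_filter I.
apply: (cvg_unique _ H H').
exact: norm_hausdorff.
Qed.

Lemma sumsD (I : choiceType) (a b : I -> R) (l l' : R) :
  sums a l -> sums b l' -> sums (fun i => a i + b i) (l + l').
Proof.
have PF := @summability.totally_filter I.
move=> H H'; rewrite /sums.
rewrite (_ : summability.partial_sum _ =
  (fun J => summability.partial_sum a J + summability.partial_sum b J)).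
  exact: cvgD.
by apply/funext => J; rewrite !partial_sumE big_split.
Qed.

Lemma sumsZ (I : choiceType) (a : I -> R) (k l : R) :
  sums a l -> sums (fun i => k * a i) (k * l).
Proof.
have PF := @summability.totally_filter I.
move=> H; rewrite /sums.
rewrite (_ : summability.partial_sum _ =
  (fun J => k * summability.partial_sum a J)).
  exact: cvgMl_tmp.
by apply/funext => J; rewrite !partial_sumE big_distrr.
Qed.

Lemma sums_norm_le (I : choiceType) (a : I -> R) (l M : R) :
  sums a l -> bounded_sums a M -> `|l| <= M.
Proof.
move=> /sumsP H B; apply/ler_addgt0Pr => e e0.
have [J /(_ J)] := H _ e0; rewrite fsubset_refl => /(_ isT) HJ.
rewrite -[l](subrK (\sum_(i <- J) a i)) addrC.
apply: le_trans (ler_normD _ _) _; apply: lerD => //.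
exact: le_trans (ler_norm_sum _ _ _) (B J).
Qed.

Lemma fsum_sub_le (I : choiceType) (a : I -> R) (J L : {fset I}) :
  (forall i, 0 <= a i) -> (J `<=` L)%fset ->
  \sum_(i <- J) a i <= \sum_(i <- L) a i.
Proof.
move=> a0 JL; rewrite (big_fsetID _ (mem J) L) /=.
rewrite (_ : [fset x in L | x \in J]%fset = J); last first.
  apply/fsetP => x; rewrite !inE; apply/andP/idP => [[]//|xJ].
  by split=> //; apply: (fsubsetP JL).
by rewrite lerDl; apply: sumr_ge0.
Qed.

(** Write [a] as the difference of [`|a| + a] and [`|a|]: for a nonnegative family
the supremum of the finite partial sums is the sum. *)
Lemma bounded_sums_cvg (I : choiceType) (a : I -> R) (M : R) :
  bounded_sums a M -> exists l, sums a l.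
Proof.
have pos (b : I -> R) (B : R) : (forall i, 0 <= b i) ->
    (forall J : {fset I}, \sum_(i <- J) b i <= B) -> exists l, sums b l.
  move=> b0 bB; pose S := [set \sum_(i <- J) b i | J in [set: {fset I}]].
  have hS : has_sup S.
    split; first by exists (\sum_(i <- fset0) b i); exists fset0.
    by exists B => _ [J _ <-].
  exists (sup S); apply/sumsP => e e0.
  have [_ [J _ <-] HJ] := sup_adherent e0 hS; exists J => L JL.
  have le1 := fsum_sub_le b0 JL.
  have le2 : \sum_(i <- L) b i <= sup S by apply: (ub_le_sup hS.2); exists L.
  rewrite ger0_norm ?subr_ge0//; lra.
move=> aM.
have [l1 H1] : exists l, sums (fun i => `|a i| + a i) l.
  apply: (pos _ (M + M)).
    by move=> i; have := lerNnormlW (lexx `|a i|); rewrite -normrN; 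
       have := ler_norm (- a i); rewrite normrN; lra.
  move=> J; rewrite big_split /= lerD//.
  exact: le_trans (ler_norm _) (le_trans (ler_norm_sum _ _ _) (aM J)).
have [l2 H2] : exists l, sums (fun i => `|a i|) l by exact: (pos _ M).
exists (l1 + (-1) * l2).
have := sumsD H1 (sumsZ (k := -1) H2).
by rewrite (_ : (fun i => _) = a)//; apply/funext => i; lra.
Qed.

Lemma bounded_sums_le (I : choiceType) (a b : I -> R) (M : R) :
  (forall i, `|a i| <= b i) -> bounded_sums b M -> bounded_sums a M.
Proof.
move=> ab B J; apply: le_trans (B J); apply: ler_sum => i _.
exact: le_trans (ab i) (ler_norm _).
Qed.

Lemma bounded_sumsZ (I : choiceType) (a : I -> R) (k M : R) :
  bounded_sums a M -> bounded_sums (fun i => k * a i) (`|k| * M).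
Proof.
move=> B J; under eq_bigr do rewrite normrM.
by rewrite -mulr_sumr ler_wpM2l.
Qed.

(** Outside a large finite set a term is the difference of two partial sums that
are both close to the sum. *)
Lemma sums_bounded_terms (I : choiceType) (a : I -> R) (l : R) :
  sums a l -> exists B, forall i, `|a i| <= B.
Proof.
move=> /sumsP /(_ 1 ltr01)[J HJ].
exists (2 + \sum_(i <- J) `|a i|) => i.
have S0 : 0 <= \sum_(i <- J) `|a i| by apply: sumr_ge0.
have [iJ|iJ] := boolP (i \in J).
  rewrite (big_fsetD1 i) //=.
  have : 0 <= \sum_(i <- (J `\ i)%fset) `|a i| by apply: sumr_ge0.
  by lra.
have h1 := HJ J (fsubset_refl _).
have := HJ (i |` J)%fset (fsubsetU1 _ _).
rewrite big_fsetU1 //= => h2.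
have := ler_normB (l - \sum_(i <- J) a i) (l - (a i + \sum_(i <- J) a i)).
rewrite (_ : _ - _ - _ = a i); last by ring.
lra.
Qed.

(** Summing a family over rectangles and letting the second side grow first turns
the unconditional sum over pairs into the iterated one; with the symmetric
statement obtained by [sums_reindex_bij] this exchanges two sums. *)
Lemma sums_fubini (I J : choiceType) (a : I -> J -> R) (b : I -> R) (s : R) :
  sums (fun ij : I * J => a ij.1 ij.2) s -> (forall i, sums (a i) (b i)) ->
  sums b s.
Proof.
move=> /sumsP H Hb; apply/sumsP => e e0.
have [K HK] := H _ e0.
exists [fset ij.1 | ij in K]%fset => L KL.
have PF := @summability.totally_filter J.
have cv : (fun M : {fset J} => `|s - \sum_(i <- L) \sum_(j <- M) a i j|)
    @ summability.totally --> `|s - \sum_(i <- L) b i|.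
  apply: cvg_norm; apply: cvgB; first exact: cvg_cst.
  have : forall r : seq I, (fun M : {fset J} => \sum_(i <- r) \sum_(j <- M) a i j)
    @ summability.totally --> \sum_(i <- r) b i.
    elim=> [|i r IH].
      rewrite big_nil; under eq_fun do rewrite big_nil; exact: cvg_cst.
    rewrite big_cons; under eq_fun do rewrite big_cons.
    apply: cvgD => //.
      rewrite (_ : (fun M : {fset J} => _) = summability.partial_sum (a i)).
        exact: Hb.
      by apply/funext => M; rewrite partial_sumE.
    by apply.
apply: (closed_cvg (fun x : R => x <= e) (@closed_le R e) _ _ cv).
exists [fset ij.2 | ij in K]%fset => // M /= KM.
have KLM : (K `<=` [fset ((i, j) : (I * J)%type) | i in L, j in M])%fset.
  apply/fsubsetP => -[i j] ij; apply/imfset2P; exists i.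
    by apply: (fsubsetP KL); apply/imfsetP; exists (i, j).
  exists j => //; by apply: (fsubsetP KM); apply/imfsetP; exists (i, j).
have := HK _ KLM.
rewrite big_imfset2 //=.
by move=> [i j] [i' j'] _ _ /= [-> ->].
Qed.

(** [g] is a partial inverse of [h], so that [h] is injective with decidable image;
the family vanishes off that image. *)
Lemma sums_reindex (I J : choiceType) (h : J -> I) (g : I -> option J)
    (a : I -> R) (l : R) :
  pcancel h g -> ocancel g h -> (forall i, g i = None -> a i = 0) ->
  sums (fun j => a (h j)) l -> sums a l.
Proof.
move=> hg gh a0 /sumsP H; apply/sumsP => e e0; have [K HK] := H _ e0.
exists [fset h j | j in K]%fset => L KL.
suff -> : \sum_(i <- L) a i = \sum_(j <- [fset j in pmap g L]%fset) a (h j).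
  apply: HK; apply/fsubsetP => j jK; rewrite inE /= mem_pmap.
  apply/mapP; exists (h j); last by rewrite hg.
  by apply: (fsubsetP KL); apply/imfsetP; exists j.
rewrite (perm_big (pmap g L)) /=; last first.
  apply: uniq_perm => //; first by apply: (pmap_uniq gh); exact: fset_uniq.
  by move=> j; rewrite !inE.
elim: (enum_fset L) => [|i r IH]; first by rewrite !big_nil.
rewrite big_cons IH /=; case E : (g i) => [j|] /=.
  by rewrite big_cons; have := gh i; rewrite E /= => ->.
by rewrite a0 // add0r.
Qed.

Lemma sums_reindex_bij (I J : choiceType) (h : J -> I) (g : I -> J) (a : I -> R) (l : R) :
  cancel h g -> cancel g h -> sums (fun j => a (h j)) l -> sums a l.
Proof. by move=> hg gh; apply: (sums_reindex (can_pcan hg) (g := fun i => Some (g i))). Qed.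

Lemma sums_finite (I : choiceType) (a : I -> R) (s : seq I) :
  uniq s -> (forall i, i \notin s -> a i = 0) -> sums a (\sum_(i <- s) a i).
Proof.
move=> us a0; apply/sumsP => e e0; exists [fset i in s]%fset => L sL.
suff -> : \sum_(i <- L) a i = \sum_(i <- s) a i by rewrite subrr normr0 ltW.
rewrite (big_fsetID _ (mem s) L) /= [X in _ + X]big1_fset ?addr0; last first.
  by move=> i; rewrite !inE => /andP[_ /a0].
apply: perm_big; apply: uniq_perm => // i; rewrite !inE.
by apply/andP/idP => [[]//|hi]; split=> //; apply: (fsubsetP sL); rewrite inE.
Qed.


End Sums.

(** * Power series in several variables *)

Section PowerSeries.
Context {R : realType}.

Definition monomial (n : nat) (y : 'rV[R]_n) (al : mnm n) : R :=
  \prod_i y 0 i ^+ al i.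

(** Coefficients with geometric growth: this is convergence in a neighbourhood of the
origin, kept as explicit constants because they are tracked through composition
and differentiation. *)
Definition geom_bounded (n : nat) (c : mnm n -> R) (K C : R) : Prop :=
  [/\ 0 <= K, 0 < C & forall al, `|c al| <= K * C ^+ mdeg al].

Definition powsum (n : nat) (c : mnm n -> R) (y : 'rV[R]_n) : R :=
  xget 0 (sums (fun al => c al * monomial y al)).

Lemma rv_coord_le (n : nat) (y : 'rV[R]_n) (i : 'I_n) : `|y 0 i| <= `|y|.
Proof.
rewrite [leRHS]/Num.Def.normr /= mx_normrE.
by apply: le_trans (le_bigmax _ _ (0, i)).
Qed.

Lemma rv_norm_le (n : nat) (y : 'rV[R]_n) (M : R) :
  0 <= M -> (forall i, `|y 0 i| <= M) -> `|y| <= M.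
Proof.
move=> M0 H; rewrite [leLHS]/Num.Def.normr /= mx_normrE.
by apply/bigmax_leP; split=> // -[i j] _ /=; rewrite ord1.
Qed.

Lemma delta_norm n (i : 'I_n) : `|(delta_mx 0 i : 'rV[R]_n)| <= 1.
Proof.
by apply: rv_norm_le => // j; rewrite mxE; case: andP => _ /=; rewrite ?normr1 ?normr0.
Qed.

Lemma rv_norm_lt (n : nat) (y : 'rV[R]_n) (M : R) :
  0 < M -> (forall i, `|y 0 i| < M) -> `|y| < M.
Proof.
move=> M0 H; rewrite [ltLHS]/Num.Def.normr /= mx_normrE.
by apply/bigmax_ltP; split=> // -[i j] _ /=; rewrite ord1.
Qed.

Lemma monomial_le (n : nat) (y : 'rV[R]_n) (al : mnm n) (r : R) :
  `|y| <= r -> `|monomial y al| <= r ^+ mdeg al.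
Proof.
move=> yr; rewrite /monomial normr_prod mpoly.mdegE -prodrXr.
apply: ler_prod => i _; rewrite normr_ge0 normrX /=.
by apply: lerXn2r; rewrite ?nnegrE ?(le_trans _ yr)//; exact: rv_coord_le.
Qed.

Lemma geom_sum_le (r : R) (N : nat) : 0 <= r -> r < 1 ->
  \sum_(k < N) r ^+ k <= (1 - r)^-1.
Proof.
move=> r0 r1; have p : 0 < 1 - r by lra.
rewrite -(ler_pM2l p) divff ?gt_eqF//.
have := subrX1 r N.
have : 0 <= r ^+ N by apply: exprn_ge0.
lra.
Qed.

(** A finite set of multi-indices lies in a box, and over a box the sum of
[r ^+ mdeg al] factors into [n] geometric sums. *)
Lemma bounded_sums_geometric (n : nat) (r : R) : 0 <= r -> r < 1 ->
  bounded_sums (fun al : mnm n => r ^+ mdeg al) ((1 - r)^-1 ^+ n).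
Proof.
move=> r0 r1 J.
pose N := (\max_(al <- J) mdeg al).+1.
pose h (f : {ffun 'I_n -> 'I_N}) : mnm n := mpoly.Multinom [tuple (f i : nat) | i < n].
have hE f i : h f i = f i :> nat by rewrite /h mpoly.mnmE.
have hI : injective h.
  by move=> f g fg; apply/ffunP => i; apply: val_inj; rewrite /= -!hE fg.
pose L := [fset h f | f in {: {ffun 'I_n -> 'I_N}}]%fset.
have JL : (J `<=` L)%fset.
  apply/fsubsetP => al alJ; apply/imfsetP => /=.
  have lt i : (al i < N)%N.
    rewrite ltnS; apply: (@leq_trans (mdeg al)).
      by rewrite mpoly.mdegE (bigD1 i) //= leq_addr.
    by rewrite (big_rem al) //= leq_max leqnn.
  exists [ffun i => Ordinal (lt i)] => //.
  by apply/mpoly.mnmP => i; rewrite hE ffunE.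
under eq_bigr do rewrite ger0_norm ?exprn_ge0//.
apply: le_trans (fsum_sub_le _ JL) _; first by move=> i; apply: exprn_ge0.
rewrite big_imfset /=; last by move=> f g _ _; apply: hI.
rewrite big_enum /=.
rewrite (eq_bigr (fun f : {ffun 'I_n -> 'I_N} => \prod_(i < n) r ^+ f i)); last first.
  move=> f _; rewrite mpoly.mdegE -prodrXr.
  by apply: eq_bigr => i _; rewrite hE.
rewrite -(bigA_distr_bigA (fun (i : 'I_n) (k : 'I_N) => r ^+ k)) /=.
rewrite -[leRHS](_ : \prod_(i < n) (1 - r)^-1 = _); last first.
  by rewrite prodr_const card_ord.
apply: ler_prod => i _; rewrite geom_sum_le// andbT.
by apply: sumr_ge0 => k _; apply: exprn_ge0.
Qed.

Lemma geom_bounded_term (n : nat) (c : mnm n -> R) K C (y : 'rV[R]_n) al :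
  geom_bounded c K C -> `|c al * monomial y al| <= K * (C * `|y|) ^+ mdeg al.
Proof.
case=> K0 C0 H; rewrite normrM exprMn mulrA.
by apply: ler_pM => //; exact: monomial_le.
Qed.

Lemma geom_bounded_sums (n : nat) (c : mnm n -> R) K C (y : 'rV[R]_n) :
  geom_bounded c K C -> C * `|y| < 1 ->
  bounded_sums (fun al => c al * monomial y al) (K * (1 - C * `|y|)^-1 ^+ n).
Proof.
move=> g lt1; have [K0 C0 _] := g.
apply: (@bounded_sums_le _ _ _ (fun al => K * (C * `|y|) ^+ mdeg al)).
  by move=> al; exact: geom_bounded_term.
rewrite (_ : K * _ = `|K| * (1 - C * `|y|)^-1 ^+ n); last by rewrite ger0_norm.
by apply: bounded_sumsZ; apply: bounded_sums_geometric => //; rewrite mulr_ge0 ?(ltW C0).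
Qed.

Lemma sums_powsum (n : nat) (c : mnm n -> R) (y : 'rV[R]_n) (l : R) :
  sums (fun al => c al * monomial y al) l -> powsum c y = l.
Proof.
move=> H; rewrite /powsum; apply: (sums_uniq _ H).
by apply: xgetPex; exists l.
Qed.

Lemma powsumP (n : nat) (c : mnm n -> R) K C (y : 'rV[R]_n) :
  geom_bounded c K C -> C * `|y| < 1 -> sums (fun al => c al * monomial y al) (powsum c y).
Proof.
move=> g lt1; have [l Hl] := bounded_sums_cvg (geom_bounded_sums g lt1).
by rewrite (sums_powsum Hl).
Qed.

Definition partial_powsum (n : nat) (c : mnm n -> R) (N : nat) (y : 'rV[R]_n) : R :=
  \sum_(al : mpoly.bmultinom n N) c al * monomial y al.

Lemma sums_partial_powsum (n : nat) (c : mnm n -> R) (N : nat) (y : 'rV[R]_n) :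
  sums (fun al => if (mdeg al < N)%N then c al * monomial y al else 0)
    (partial_powsum c N y).
Proof.
pose s := [seq (val al) | al <- enum {: mpoly.bmultinom n N}].
have us : uniq s by rewrite map_inj_uniq ?enum_uniq//; exact: val_inj.
have ms al : (al \in s) = (mdeg al < N)%N.
  apply/mapP/idP => [[b _ ->]|lt]; first exact: mpoly.bmdeg.
  by exists (mpoly.BMultinom lt) => //; rewrite mem_enum.
rewrite (_ : partial_powsum c N y =
    \sum_(al <- s) if (mdeg al < N)%N then c al * monomial y al else 0).
  by apply: sums_finite => // al; rewrite ms => /negbTE ->.
rewrite big_map big_enum /=; apply: eq_bigr => al _.
by rewrite mpoly.bmdeg.
Qed.

(** The factor [2] pays for the sum of the remaining terms: as their degrees are at
least [N], each is at most [K * (2 * C * `|y|) ^+ N] times a power of [2^-1]. *)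
Lemma powsum_remainder (n : nat) (c : mnm n -> R) K C (y : 'rV[R]_n) (N : nat) :
  geom_bounded c K C -> 2 * C * `|y| <= 1 ->
  `|powsum c y - partial_powsum c N y| <= K * 2 ^+ n * (2 * C * `|y|) ^+ N.
Proof.
move=> g le1; have [K0 C0 _] := g.
have y0 : 0 <= C * `|y| by rewrite mulr_ge0 ?(ltW C0).
have lt1 : C * `|y| < 1 by lra.
have := sumsD (powsumP g lt1) (sumsZ (k := -1) (@sums_partial_powsum n c N y)).
rewrite mulN1r => /sums_norm_le; apply.
apply: (@bounded_sums_le _ _ _ (fun al => (K * (2 * C * `|y|) ^+ N) * 2^-1 ^+ mdeg al)).
  move=> al; case: ifPn => [lt|]; rewrite ?mulr0 ?addr0 ?mulN1r ?subrr ?normr0.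
    by rewrite !mulr_ge0// ?exprn_ge0//; lra.
  rewrite -leqNgt => le; apply: (le_trans (geom_bounded_term y al g)).
  rewrite -mulrA; apply: ler_wpM2l => //.
  rewrite (_ : C * `|y| = (2 * C * `|y|) * 2^-1); last by field.
  rewrite exprMn; apply: ler_wpM2r; first by rewrite exprn_ge0.
  by apply: ler_wiXn2l => //; lra.
have -> : K * 2 ^+ n * (2 * C * `|y|) ^+ N =
   `|K * (2 * C * `|y|) ^+ N| * (1 - 2^-1)^-1 ^+ n.
  rewrite ger0_norm ?mulr_ge0 ?exprn_ge0//; last lra.
  by rewrite (_ : (1 - 2^-1)^-1 = 2 :> R); [ring | field].
by apply: bounded_sumsZ; apply: bounded_sums_geometric; lra.
Qed.

Definition mnm_of_ffun (n : nat) (f : {ffun 'I_n -> nat}) : mnm n :=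
  mpoly.Multinom [tuple f i | i < n].
Definition ffun_of_mnm (n : nat) (al : mnm n) : {ffun 'I_n -> nat} :=
  [ffun i => al i].

Lemma mnm_of_ffunK n : cancel (@mnm_of_ffun n) (@ffun_of_mnm n).
Proof. by move=> f; apply/ffunP => i; rewrite ffunE mpoly.mnmE. Qed.

Lemma ffun_of_mnmK n : cancel (@ffun_of_mnm n) (@mnm_of_ffun n).
Proof. by move=> al; apply/mpoly.mnmP => i; rewrite mpoly.mnmE ffunE. Qed.

(** Convergence at a single point with all coordinates offset by [r > 0] bounds the
coefficients geometrically; this constructive form replaces the limit over
finite sets in the definition. *)
Lemma analytic_atP (n : nat) (F : 'rV[R]_n -> R) (a : 'rV[R]_n) :
  analytic_at F a <-> exists c K C, geom_bounded c K C /\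
    \forall x \near a, F x = powsum c (x - a).
Proof.
split; last first.
  move=> [c [K [C [g H]]]]; exists (fun f => c (mnm_of_ffun f)).
  have [K0 C0 _] := g.
  near=> x.
  have -> : F x = powsum c (x - a) by near: x.
  have lt1 : C * `|x - a| < 1.
    rewrite mulrC -ltr_pdivlMr// mul1r distrC; near: x.
    apply/nbhs_ballP; exists C^-1 => /=; first by rewrite invr_gt0.
    by move=> x; rewrite -ball_normE.
  apply: (sums_reindex_bij (@ffun_of_mnmK n) (@mnm_of_ffunK n)).
  have := powsumP g lt1; congr sums; apply/funext => al.
  rewrite ffun_of_mnmK /monomial; congr (_ * _); apply: eq_bigr => i _.
  by rewrite !mxE ffunE.
move=> [c /nbhs_ballP[e /= e0 H]].
pose r := e / 2; have r0 : 0 < r by rewrite divr_gt0.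
have [B HB] : exists B, forall k, `|c k| * r ^+ (\sum_i k i) <= B.
  have /H : ball a e (a + const_mx r).
    rewrite -ball_normE /= opprD addrA subrr add0r normrN.
    apply: (@le_lt_trans _ _ r); last by rewrite /r; lra.
    apply: rv_norm_le => [|i]; first exact: ltW.
    by rewrite mxE ger0_norm// ltW.
  move=> /sums_bounded_terms[B HB]; exists B => k; apply: le_trans (HB k).
  rewrite normrM; apply: ler_wpM2l => //.
  rewrite -prodrXr normr_prod; apply: ler_prod => i _.
  rewrite !mxE addrAC subrr add0r normrX (ger0_norm (ltW r0)) lexx andbT.
  by apply: exprn_ge0; exact: ltW.
exists (fun al => c (ffun_of_mnm al)), B, r^-1; split.
  split; rewrite ?invr_gt0//.
    apply: le_trans (HB [ffun=> 0%N]); apply: mulr_ge0 => //.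
    by apply: exprn_ge0; exact: ltW.
  move=> al; rewrite exprVn ler_pdivlMr ?exprn_gt0//.
  rewrite mpoly.mdegE; apply: le_trans (HB (ffun_of_mnm al)).
  rewrite (_ : (\sum_i ffun_of_mnm al i = \sum_(i < n) al i)%N)//.
  by apply: eq_bigr => i _; rewrite ffunE.
apply/nbhs_ballP; exists e => //= x /H Hx; apply/esym/sums_powsum.
apply: (sums_reindex_bij (@mnm_of_ffunK n) (@ffun_of_mnmK n)).
move: Hx; congr sums; apply/funext => k.
rewrite mnm_of_ffunK /monomial; congr (_ * _); apply: eq_bigr => i _.
by rewrite !mxE mpoly.mnmE.
Unshelve. all: by end_near. Qed.

End PowerSeries.

(** * Substitution of polynomials in power series *)

Section Composition.
Context {R : realType}.

Definition mpoly_abs (m : nat) (q : mpoly.mpoly m R) : mpoly.mpoly m R :=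
  \sum_(be <- mpoly.msupp q) `|mpoly.mcoeff be q| *: mpoly.mpolyX R be.

Lemma mcoeff_mpoly_abs m (q : mpoly.mpoly m R) be :
  mpoly.mcoeff be (mpoly_abs q) = `|mpoly.mcoeff be q|.
Proof.
rewrite /mpoly_abs raddf_sum /=.
under eq_bigr do rewrite mpoly.mcoeffZ mpoly.mcoeffX.
have [H|H] := boolP (be \in mpoly.msupp q).
  rewrite (bigD1_seq be) ?mpoly.msupp_uniq//= eqxx mulr1 big1 ?addr0//.
  by move=> i /negbTE ->; rewrite mulr0.
rewrite (mpoly.memN_msupp_eq0 H) normr0 big_seq big1// => i iq.
by case: eqP => [E|]; rewrite ?mulr0//; rewrite -E iq in H.
Qed.

(** Cauchy's majorants: [Q] dominates [q] coefficientwise, a relation stable under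
products, so that the absolute coefficients of a product of powers can be
summed by evaluating the corresponding product of the majorants. *)
Definition majorizes m (q Q : mpoly.mpoly m R) : Prop :=
  forall be, `|mpoly.mcoeff be q| <= mpoly.mcoeff be Q.

Lemma majorizesM m (p P q Q : mpoly.mpoly m R) :
  majorizes p P -> majorizes q Q -> majorizes (p * q) (P * Q).
Proof.
move=> hp hq be; rewrite !mpoly.mcoeffM.
apply: le_trans (ler_norm_sum _ _ _) _; apply: ler_sum => k _.
by rewrite normrM; apply: ler_pM.
Qed.

Lemma majorizes1 m : majorizes (1 : mpoly.mpoly m R) 1.
Proof. by move=> be; rewrite mpoly.mcoeff1 normr_nat. Qed.

Lemma majorizesX m (q Q : mpoly.mpoly m R) k : majorizes q Q -> majorizes (q ^+ k) (Q ^+ k).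
Proof.
move=> h; elim: k => [|k IH]; first by rewrite !expr0; exact: majorizes1.
by rewrite !exprS; apply: majorizesM.
Qed.

Lemma majorizes_prod m n (q Q : 'I_n -> mpoly.mpoly m R) :
  (forall i, majorizes (q i) (Q i)) -> majorizes (\prod_i q i) (\prod_i Q i).
Proof.
by move=> h; elim/big_ind2: _ => //; [exact: majorizes1|move=> *; exact: majorizesM].
Qed.

Lemma majorizes_sum_le m (q Q : mpoly.mpoly m R) (r : R) (J : {fset mnm m}) :
  0 <= r -> majorizes q Q ->
  \sum_(be <- J) `|mpoly.mcoeff be q| * r ^+ mdeg be <= mpoly.meval (fun=> r) Q.
Proof.
move=> r0 h.
have Q0 be : 0 <= mpoly.mcoeff be Q by apply: le_trans (h be).
apply: (@le_trans _ _ (\sum_(be <- J) mpoly.mcoeff be Q * r ^+ mdeg be)).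
  by apply: ler_sum => be _; rewrite ler_wpM2r ?exprn_ge0.
have F0 be : 0 <= mpoly.mcoeff be Q * r ^+ mdeg be by rewrite mulr_ge0 ?exprn_ge0.
rewrite mpoly.mevalE.
rewrite [leRHS](_ : _ = \sum_(be <- [fset be in mpoly.msupp Q]%fset)
   mpoly.mcoeff be Q * r ^+ mdeg be); last first.
  rewrite [RHS](perm_big (mpoly.msupp Q)) /=; last first.
    by apply: uniq_perm; rewrite ?fset_uniq ?mpoly.msupp_uniq// => i; rewrite !inE.
  by apply: eq_bigr => be _; rewrite mpoly.mdegE -prodrXr.
apply: (@le_trans _ _ (\sum_(be <- (J `|` [fset be in mpoly.msupp Q])%fset)
   mpoly.mcoeff be Q * r ^+ mdeg be)).
  by apply: fsum_sub_le => //; exact: fsubsetUl.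
rewrite (big_fsetID _ (mem (mpoly.msupp Q))) /= [X in _ + X]big1_fset ?addr0.
  apply: fsum_sub_le => //; apply/fsubsetP => be; rewrite !inE.
  by move=> /andP[].
move=> be; rewrite !inE => /andP[_ H] _.
by rewrite (mpoly.memN_msupp_eq0 H) mul0r.
Qed.

Lemma sums_meval m (q : mpoly.mpoly m R) (y : 'rV[R]_m) :
  sums (fun be => mpoly.mcoeff be q * monomial y be) (mpoly.meval (y 0) q).
Proof.
rewrite mpoly.mevalE; apply: sums_finite; first exact: mpoly.msupp_uniq.
by move=> be H; rewrite (mpoly.memN_msupp_eq0 H) mul0r.
Qed.

Lemma majorizes_meval m (q Q : mpoly.mpoly m R) (y : 'rV[R]_m) (r : R) :
  majorizes q Q -> `|y| <= r -> `|mpoly.meval (y 0) q| <= mpoly.meval (fun=> r) Q.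
Proof.
move=> h yr; apply: (sums_norm_le (@sums_meval _ q y)) => J.
have r0 : 0 <= r by apply: le_trans yr.
apply: le_trans (majorizes_sum_le J r0 h); apply: ler_sum => be _.
by rewrite normrM ler_wpM2l// monomial_le.
Qed.

Lemma majorizes_abs m (q : mpoly.mpoly m R) : majorizes q (mpoly_abs q).
Proof. by move=> be; rewrite mcoeff_mpoly_abs. Qed.

Lemma mpoly_abs_ge0 m (q : mpoly.mpoly m R) (r : R) : 0 <= r ->
  0 <= mpoly.meval (fun=> r) (mpoly_abs q).
Proof.
move=> r0; apply: le_trans (majorizes_sum_le fset0 r0 (@majorizes_abs m q)).
by rewrite big_seq_fset0.
Qed.

(** As [r] tends to [0], the sum of the absolute values of the terms tends to that of
the constant one. *)
Lemma meval_mpoly_abs_le m (q : mpoly.mpoly m R) (r : R) : 0 <= r <= 1 ->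
  mpoly.meval (fun=> r) (mpoly_abs q) <=
  `|mpoly.mcoeff mpoly.mnm0 q| + r * mpoly.meval (fun=> 1) (mpoly_abs q).
Proof.
move=> /andP[r0 r1].
have E x : mpoly.meval (fun=> x) (mpoly_abs q) =
   \sum_(be <- mpoly.msupp q) `|mpoly.mcoeff be q| * x ^+ mdeg be.
  rewrite /mpoly_abs raddf_sum; apply: eq_bigr => be _ /=.
  by rewrite mpoly.mevalZ mpoly.mevalX mpoly.mdegE -prodrXr.
rewrite !E mulr_sumr.
have [H|H] := boolP (mpoly.mnm0 \in mpoly.msupp q).
  rewrite !(bigD1_seq _ H) ?mpoly.msupp_uniq//= mpoly.mdeg0 !expr0 !mulr1.
  rewrite lerD// -[leLHS]add0r; apply: lerD; first by rewrite mulr_ge0.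
  apply: ler_sum => be b0; rewrite expr1n mulr1 mulrC ler_wpM2r//.
  by rewrite -[leRHS]expr1; apply: ler_wiXn2l => //; rewrite lt0n mpoly.mdeg_eq0.
rewrite -[leLHS]add0r; apply: lerD => //.
rewrite big_seq [leRHS]big_seq; apply: ler_sum => be bq.
rewrite expr1n mulr1 mulrC ler_wpM2r//.
rewrite -[leRHS]expr1; apply: ler_wiXn2l => //; rewrite lt0n mpoly.mdeg_eq0.
by apply: contra H => /eqP <-.
Qed.

(** Expand each monomial [q ^ al] and sum over all pairs of multi-indices.  On a small
polydisc the majorants of the [q i] stay below some [s] with [C * s < 1], so the
double family is absolutely summable and the order of summation can be
exchanged.  Small constant terms are allowed in [q] for the sake of changes of
centre. *)
Lemma powsum_comp_poly n m (c : mnm n -> R) K C (q : 'I_n -> mpoly.mpoly m R) :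
  geom_bounded c K C -> (forall i, C * `|mpoly.mcoeff mpoly.mnm0 (q i)| < 1) ->
  exists b K' C', geom_bounded b K' C' /\
    forall y, C' * `|y| < 1 -> powsum c (polymap q y) = powsum b y.
Proof.
move=> g lt1; have [K0 C0 gc] := g.
(* [s] lies halfway between the largest constant term and [C^-1]. *)
have [r [s [r0 s0 Cs Hs]]] : exists r s, [/\ 0 < r, 0 < s, C * s < 1 &
    forall i, mpoly.meval (fun=> r) (mpoly_abs (q i)) <= s].
  pose B := \sum_i mpoly.meval (fun=> 1) (mpoly_abs (q i)).
  have B0 : 0 <= B by apply: sumr_ge0 => i _; exact: mpoly_abs_ge0.
  pose M := \big[Num.max/0]_i `|mpoly.mcoeff mpoly.mnm0 (q i)|.
  have M0 : 0 <= M by apply: bigmax_ge_id.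
  have CM : C * M < 1.
    rewrite mulrC -ltr_pdivlMr// mul1r; apply/bigmax_ltP; split.
      by rewrite invr_gt0.
    by move=> i _; rewrite -[ltRHS]mul1r ltr_pdivlMr// mulrC.
  pose d := C^-1 - M.
  have d0 : 0 < d by rewrite /d subr_gt0 -[ltRHS]mul1r ltr_pdivlMr// mulrC.
  pose r := Num.min 1 (d / 2 / (B + 1)).
  have r0 : 0 < r by rewrite lt_min ltr01 !divr_gt0//; lra.
  exists r, (M + d / 2); split => //.
  - lra.
  - have -> : C * (M + d / 2) = C * M / 2 + 1 / 2 by rewrite /d; field; lra.
    lra.
  move=> i; apply: (le_trans (@meval_mpoly_abs_le _ (q i) r _)).
    by rewrite ltW//= ge_min lexx.
  apply: lerD; first exact: le_bigmax.
  have : r * (B + 1) <= d / 2.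
    by rewrite -ler_pdivlMr ?ge_min ?lexx ?orbT//; lra.
  apply: le_trans; apply: ler_wpM2l; first exact: ltW.
  rewrite /B (bigD1 i) //= -addrA lerDl.
  by apply: addr_ge0 => //; apply: sumr_ge0 => j _; exact: mpoly_abs_ge0.
pose q_ al := mpoly.mmap1 q al.
pose Q_ (al : mnm n) := \prod_i mpoly_abs (q i) ^+ al i.
have qQ al : majorizes (q_ al) (Q_ al).
  by apply: majorizes_prod => i; apply: majorizesX; exact: majorizes_abs.
have Qs al : mpoly.meval (fun=> r) (Q_ al) <= s ^+ mdeg al.
  rewrite /Q_ rmorph_prod mpoly.mdegE -prodrXr /=; apply: ler_prod => i _.
  rewrite rmorphXn /=.
  have p0 := @mpoly_abs_ge0 _ (q i) r (ltW r0).
  by rewrite exprn_ge0//= lerXn2r// nnegrE// ltW.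
pose L := K * (1 - C * s)^-1 ^+ n.
have L0 : 0 <= L by rewrite mulr_ge0// exprn_ge0// invr_ge0; lra.
have colS be : bounded_sums (fun al => c al * mpoly.mcoeff be (q_ al)) (L / r ^+ mdeg be).
  apply: (@bounded_sums_le _ _ _ (fun al => (K / r ^+ mdeg be) * (C * s) ^+ mdeg al)).
    move=> al; rewrite normrM mulrAC ler_pdivlMr ?exprn_gt0// exprMn.
    rewrite -mulrA [K * _]mulrA; apply: ler_pM => //.
      by rewrite mulr_ge0// exprn_ge0// ltW.
    apply: le_trans (Qs al).
    have := majorizes_sum_le [fset be]%fset (ltW r0) (qQ al).
    by rewrite big_seq_fset1.
  have -> : L / r ^+ mdeg be = `|K / r ^+ mdeg be| * (1 - C * s)^-1 ^+ n.
    rewrite ger0_norm ?mulr_ge0 ?invr_ge0 ?exprn_ge0 ?(ltW r0)//.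
    by rewrite /L mulrAC.
  apply: bounded_sumsZ; apply: bounded_sums_geometric => //; by rewrite mulr_ge0// ltW.
have /choice[b Hb] be : exists b, sums (fun al => c al * mpoly.mcoeff be (q_ al)) b.
  exact: bounded_sums_cvg (colS be).
exists b, L, r^-1; split.
  split=> //; first by rewrite invr_gt0.
  by move=> be; rewrite exprVn; exact: sums_norm_le (Hb be) (colS be).
move=> y; rewrite mulrC ltr_pdivrMr// mul1r => yr.
have py : C * `|polymap q y| < 1.
  apply: le_lt_trans Cs; apply: ler_wpM2l; first exact: ltW.
  apply: rv_norm_le => [|i]; first exact: ltW.
  rewrite mxE; apply: le_trans (Hs i).
  by apply: majorizes_meval (ltW yr); exact: majorizes_abs.
(* Enlarge a finite set of pairs to a rectangle to sum each variable separately. *)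
have dS : bounded_sums (fun ab : mnm n * mnm m =>
    c ab.1 * mpoly.mcoeff ab.2 (q_ ab.1) * monomial y ab.2) L.
  move=> J.
  pose A := [fset ab.1 | ab in J]%fset.
  pose B := [fset ab.2 | ab in J]%fset.
  apply: (@le_trans _ _ (\sum_(ab <-
      [fset ((a, b) : (mnm n * mnm m)%type) | a in A, b in B]%fset)
     `|c ab.1 * mpoly.mcoeff ab.2 (q_ ab.1) * monomial y ab.2|)).
    apply: fsum_sub_le => //; apply/fsubsetP => -[u v] uv.
    apply/imfset2P; exists u; first by apply/imfsetP; exists (u, v).
    by exists v => //; apply/imfsetP; exists (u, v).
  rewrite big_imfset2 /=; last by move=> [? ?] [? ?] _ _ /= [-> ->].
  apply: (@le_trans _ _ (\sum_(a <- A) K * (C * s) ^+ mdeg a)).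
    apply: ler_sum => a _.
    apply: (@le_trans _ _ (`|c a| * \sum_(be <- B)
       `|mpoly.mcoeff be (q_ a)| * r ^+ mdeg be)).
      rewrite mulr_sumr; apply: ler_sum => be _.
      rewrite !normrM -mulrA; do 2! apply: ler_wpM2l => //.
      by apply: monomial_le; exact: ltW.
    rewrite exprMn mulrA; apply: ler_pM => //.
      by apply: sumr_ge0 => be _; rewrite mulr_ge0// exprn_ge0// ltW.
    by apply: le_trans (Qs a); apply: majorizes_sum_le => //; exact: ltW.
  rewrite -mulr_sumr; apply: ler_wpM2l => //.
  have Cs0 : 0 <= C * s by rewrite mulr_ge0// ltW.
  have := bounded_sums_geometric (n := n) Cs0 Cs A.
  by under eq_bigr do rewrite ger0_norm ?exprn_ge0//.
have [S HS] := bounded_sums_cvg dS.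
have inner1 al : sums (fun be => c al * mpoly.mcoeff be (q_ al) * monomial y be)
    (c al * monomial (polymap q y) al).
  rewrite (_ : (fun _ => _) =
     (fun be => c al * (mpoly.mcoeff be (q_ al) * monomial y be))); last first.
    by apply/funext => be; rewrite mulrA.
  rewrite (_ : monomial (polymap q y) al = mpoly.meval (y 0) (q_ al)).
    by apply: sumsZ; exact: sums_meval.
  rewrite /monomial /q_ /mpoly.mmap1 rmorph_prod; apply: eq_bigr => i _.
  by rewrite mxE rmorphXn.
have inner2 be : sums (fun al => c al * mpoly.mcoeff be (q_ al) * monomial y be)
    (b be * monomial y be).
  rewrite mulrC (_ : (fun _ => _) =
     (fun al => monomial y be * (c al * mpoly.mcoeff be (q_ al)))); last first.
    by apply/funext => al; rewrite mulrC.
  by apply: sumsZ; exact: Hb.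
have E1 := sums_powsum (sums_fubini HS inner1).
have HS' : sums (fun ba : mnm m * mnm n =>
    c ba.2 * mpoly.mcoeff ba.1 (q_ ba.2) * monomial y ba.1) S.
  pose sw1 (ba : mnm m * mnm n) := (ba.2, ba.1).
  pose sw2 (ab : mnm n * mnm m) := (ab.2, ab.1).
  by apply: (@sums_reindex_bij _ _ _ sw2 sw1) => [[? ?]|[? ?]|].
have E2 := sums_powsum (sums_fubini HS' inner2).
by rewrite E1 E2.
Qed.

End Composition.

(** * Analytic functions are smooth *)

Section AnalyticSmooth.
Context {R : realType}.

Lemma near_ball_intro n (P : 'rV[R]_n -> Prop) (e : R) (a : 'rV[R]_n) : 0 < e ->
  (forall x, `|x - a| < e -> P x) -> \forall x \near a, P x.
Proof.
move=> e0 H; apply/nbhs_ballP; exists e => //= x.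
by rewrite -ball_normE /= distrC => /H.
Qed.

Lemma near_ball_elim n (P : 'rV[R]_n -> Prop) (a : 'rV[R]_n) :
  (\forall x \near a, P x) -> exists2 e : R, 0 < e & forall x, `|x - a| < e -> P x.
Proof.
move=> /nbhs_ballP[e /= e0 H]; exists e => // x xa; apply: H.
by rewrite -ball_normE /= distrC.
Qed.

(** Change of centre: substitute the polynomials [x0 - z + 'X_i]. *)
Lemma powsum_analytic_at n (c : mnm n -> R) K C (x0 z : 'rV[R]_n) :
  geom_bounded c K C -> C * `|x0 - z| < 1 -> analytic_at (fun x => powsum c (x - z)) x0.
Proof.
move=> g lt1; have [K0 C0 _] := g.
pose q i : mpoly.mpoly n R := mpoly.mpolyC n ((x0 - z) 0 i) + mpoly.mpolyX R (mpoly.mnm1 i).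
have qE y : polymap q y = x0 - z + y.
  apply/rowP => i; rewrite mxE /q mpoly.mevalD mpoly.mevalC mpoly.mevalXU.
  by rewrite !mxE.
have [i|b [K' [C' [g' H]]]] := powsum_comp_poly (q := q) g.
  rewrite /q mpoly.mcoeffD mpoly.mcoeffC eqxx mulr1 mpoly.mcoeffX mpoly.mnm1_eq0 addr0.
  by apply: le_lt_trans lt1; apply: ler_wpM2l; [exact: ltW|exact: rv_coord_le].
apply/analytic_atP; exists b, K', C'; split => //.
have [_ C'0 _] := g'.
apply: (@near_ball_intro _ _ C'^-1); first by rewrite invr_gt0.
move=> x xx; rewrite -H.
  by rewrite qE; congr powsum; apply/rowP => i; rewrite !mxE; ring.
by rewrite mulrC -ltr_pdivlMr// mul1r.
Qed.

Lemma monomial0 n (al : mnm n) : monomial (0 : 'rV[R]_n) al = (al == mpoly.mnm0)%:R.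
Proof.
case: eqP => [->|/eqP H].
  by rewrite /monomial big1// => i _; rewrite mpoly.mnm0E expr0.
apply/eqP; rewrite -normr_le0; apply: le_trans (monomial_le _ (lexx _)) _.
by rewrite normr0 expr0n mpoly.mdeg_eq0 (negbTE H).
Qed.

Lemma meval_0 m (q : mpoly.mpoly m R) :
  mpoly.meval ((0 : 'rV[R]_m) 0) q = mpoly.mcoeff mpoly.mnm0 q.
Proof.
apply: (sums_uniq (@sums_meval _ _ q 0)).
have := @sums_finite R _ (fun be => mpoly.mcoeff be q * monomial 0 be)
   [:: mpoly.mnm0] isT.
rewrite big_seq1 monomial0 eqxx mulr1; apply=> be; rewrite inE monomial0 => /negbTE ->.
by rewrite mulr0.
Qed.

Lemma analytic_at_comp n m (F : 'rV[R]_n -> R) (p : 'I_n -> mpoly.mpoly m R) :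
  analytic_at F (polymap p 0) -> analytic_at (fun t => F (polymap p t)) 0.
Proof.
move=> /analytic_atP[c [K [C [g /near_ball_elim[e e0 He]]]]]; have [K0 C0 _] := g.
pose a := polymap p 0.
pose q i := p i - mpoly.mpolyC m (a 0 i).
have qE y : polymap q y = polymap p y - a.
  apply/rowP => i; rewrite [LHS]mxE /q mpoly.mevalB mpoly.mevalC.
  by rewrite !mxE.
have q0 i : mpoly.mcoeff mpoly.mnm0 (q i) = 0.
  by have /rowP/(_ i) := qE 0; rewrite subrr !mxE -meval_0.
have [i|b [K' [C' [g' H]]]] := powsum_comp_poly (q := q) g.
  by rewrite q0 normr0 mulr0.
have [_ C'0 _] := g'.
apply/analytic_atP; exists b, K', C'; split => //.
pose B := \sum_i mpoly.meval (fun=> 1) (mpoly_abs (q i)).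
have mp0 i := @mpoly_abs_ge0 R _ (q i) 1 ler01.
have B0 : 0 <= B by apply: sumr_ge0.
pose d := Num.min (Num.min 1 C'^-1) (e / (B + 1)).
have d0 : 0 < d by rewrite !lt_min ltr01 invr_gt0 C'0 divr_gt0//; lra.
apply: (near_ball_intro d0) => t; rewrite subr0 => td.
have [t1 tC te] : [/\ `|t| <= 1, C' * `|t| < 1 & `|t| * (B + 1) < e].
  split.
  - by apply: ltW (lt_le_trans td _); rewrite !ge_min lexx.
  - by rewrite mulrC -ltr_pdivlMr// mul1r (lt_le_trans td)// !ge_min lexx orbT.
  - by rewrite -ltr_pdivlMr ?(lt_le_trans td)// ?ge_min ?lexx ?orbT//; lra.
rewrite -H // qE He //.
rewrite -[X in `|X|]qE; apply: le_lt_trans te; apply: rv_norm_le => [|i].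
  by rewrite mulr_ge0//; lra.
rewrite mxE; apply: le_trans (majorizes_meval (@majorizes_abs _ _ (q i)) (lexx _)) _.
apply: le_trans (meval_mpoly_abs_le _ _) _; first by rewrite normr_ge0.
rewrite q0 normr0 add0r; apply: ler_wpM2l => //.
rewrite /B (bigD1 i) //= -addrA lerDl.
by apply: addr_ge0 => //; apply: sumr_ge0.
Qed.

Lemma bmultinom1_eq0 n (al : mpoly.bmultinom n 1) : (al : mnm n) = mpoly.mnm0.
Proof.
by apply/eqP; rewrite -mpoly.mdeg_eq0 -leqn0 -ltnS; exact: mpoly.bmdeg.
Qed.

Lemma partial_powsum1 n (c : mnm n -> R) y : partial_powsum c 1 y = c mpoly.mnm0.
Proof.
rewrite /partial_powsum (bigD1 (@mpoly.bm0 n 0)) //= big1 ?addr0; last first.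
  by move=> i /eqP; case; apply: val_inj; rewrite /= bmultinom1_eq0.
by rewrite /monomial big1 ?mulr1// => i _; rewrite mpoly.mnm0E expr0.
Qed.

Lemma powsum0 n (c : mnm n -> R) K C : geom_bounded c K C -> powsum c 0 = c mpoly.mnm0.
Proof.
move=> g; have := powsum_remainder (y := 0) 1 g; rewrite normr0 mulr0 ler01 => /(_ isT).
by rewrite expr1 mulr0 normr_le0 subr_eq0 => /eqP ->; rewrite partial_powsum1.
Qed.

Lemma analytic_continuous n (F : 'rV[R]_n -> R) (a : 'rV[R]_n) :
  analytic_at F a -> {for a, continuous F}.
Proof.
move=> /analytic_atP[c [K [C [g H]]]]; have [K0 C0 _] := g.
have Fa : F a = c mpoly.mnm0.
  by have := nbhs_singleton H; rewrite subrr (powsum0 g).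
apply/(@cvgrPdist_le _ _ _ (nbhs (a : 'rV[R]_n)) _) => e e0.
have /near_ball_elim[d d0 Hd] := H.
pose B := K * 2 ^+ n * (2 * C).
have B0 : 0 <= B by rewrite !mulr_ge0 ?exprn_ge0// ltW.
pose d' := Num.min d (Num.min (2 * C)^-1 (e / (B + 1))).
have d'0 : 0 < d' by rewrite !lt_min d0 invr_gt0 mulr_gt0// divr_gt0//; lra.
apply: (near_ball_intro d'0) => x xa.
rewrite Fa distrC Hd ?(lt_le_trans xa)// ?ge_min ?lexx// -(partial_powsum1 c (x - a)).
apply: le_trans (powsum_remainder 1 g _) _.
  rewrite mulrC -ler_pdivlMr ?mulr_gt0// mul1r (ltW (lt_le_trans xa _))//.
  by rewrite !ge_min lexx orbT.
rewrite expr1 mulrA -/B mulrC.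
have : `|x - a| * (B + 1) <= e.
  rewrite -ler_pdivlMr ?(ltW (lt_le_trans xa _))// ?ge_min ?lexx ?orbT//; lra.
by apply: le_trans; rewrite ler_wpM2l//; lra.
Qed.

Lemma is_derive_eps (V : normedModType R) (f : V -> R) (x v : V) (l : R) :
  (forall e, 0 < e -> exists2 d : R, 0 < d &
     forall t : R, `|t| < d -> `|f (t *: v + x) - f x - t * l| <= e * `|t|) ->
  is_derive x v f l.
Proof.
move=> H.
have cv : h^-1 *: (f (h *: v + x) - f x) @[h --> (0:R)^'] --> l.
  apply/cvgrPdist_le => e e0; have [d d0 Hd] := H _ e0.
  near=> h.
  have h0 : h != 0 by near: h; exact: nbhs_dnbhs_neq.
  have he : `|h| < d by near: h; exact: dnbhs0_lt.
  have -> : l - h^-1 *: (f (h *: v + x) - f x) =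
      - h^-1 * (f (h *: v + x) - f x - h * l).
    by rewrite /GRing.scale /=; field.
  rewrite normrM normrN normfV ler_pdivrMl ?normr_gt0// [X in _ <= X]mulrC.
  exact: Hd.
split; first exact: (cvgP l).
exact: cvg_lim cv.
Unshelve. all: by end_near. Qed.

(** A quadratic remainder at a point determines the derivative there. *)
Lemma is_derive_quad (V : normedModType R) (f : V -> R) (x v : V) (l B e : R) :
  0 < e -> (forall t, `|t| < e -> `|f (t *: v + x) - f x - t * l| <= B * t ^+ 2) ->
  is_derive x v f l.
Proof.
move=> e0 H; apply: is_derive_eps => d d0.
have B0 : 0 < `|B| + 1 by have := normr_ge0 B; lra.
exists (Num.min e (d / (`|B| + 1))); first by rewrite lt_min e0 divr_gt0.
move=> t; rewrite lt_min => /andP[te td]; apply: (le_trans (H t te)).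
rewrite -[t ^+ 2]ger0_norm ?sqr_ge0// normrX expr2 mulrA ler_wpM2r//.
have : `|t| * (`|B| + 1) <= d by rewrite -ler_pdivlMr// ltW.
have : B * `|t| <= `|B| * `|t| by apply: ler_wpM2r => //; exact: ler_norm.
have := normr_ge0 t; lra.
Qed.

(** The quadratic remainders [E k] of the powers satisfy
[E k.+1 = (x + t) * E k + t ^+ 2 * (k * x ^+ k.-1)]. *)
Lemma expr_quadratic (x t r : R) (k : nat) : 0 <= r -> `|x| <= r -> `|x + t| <= r ->
  r ^+ 2 * `|(x + t) ^+ k - x ^+ k - t * (k%:R * x ^+ k.-1)| <= t ^+ 2 * (4 * r) ^+ k.
Proof.
move=> r0 xr tr; elim: k => [|k IH].
  by rewrite !expr0 mul0r mulr0 subrr subr0 normr0 mulr0 mulr1 sqr_ge0.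
have -> : (x + t) ^+ k.+1 - x ^+ k.+1 - t * (k.+1%:R * x ^+ k) =
   (x + t) * ((x + t) ^+ k - x ^+ k - t * (k%:R * x ^+ k.-1)) +
   t ^+ 2 * (k%:R * x ^+ k.-1).
  rewrite !exprS -natr1; case: k {IH} => [|k] /=; first by rewrite !expr0; ring.
  by rewrite !exprS; ring.
apply: (@le_trans _ _ (r * (t ^+ 2 * (4 * r) ^+ k) + t ^+ 2 * (k%:R * r ^+ k.+1))).
  apply: (le_trans (ler_wpM2l (sqr_ge0 r) (ler_normD _ _))).
  rewrite mulrDr; apply: lerD.
    rewrite normrM mulrCA; apply: ler_pM => //; first by rewrite mulr_ge0 ?sqr_ge0.
  rewrite normrM (ger0_norm (sqr_ge0 t)) mulrCA ler_wpM2l ?sqr_ge0//.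
  rewrite normrM normr_nat.
  case: k {IH} => [|k] /=; first by rewrite !mul0r mulr0.
  rewrite mulrCA ler_wpM2l// normrX (_ : r ^+ k.+2 = r ^+ 2 * r ^+ k).
    by rewrite ler_wpM2l ?sqr_ge0// lerXn2r.
  by rewrite -exprD.
rewrite !exprMn !exprS.
have k4 : k%:R <= 4 ^+ k :> R by rewrite -natrX ler_nat ltnW// ltn_expl.
have -> : r * (t * (t * t ^+ 0) * (4 ^+ k * r ^+ k)) +
     t * (t * t ^+ 0) * (k%:R * (r * r ^+ k))
   = t ^+ 2 * (r * r ^+ k) * (4 ^+ k + k%:R) by ring.
have -> : t * (t * t ^+ 0) * (4 * 4 ^+ k * (r * r ^+ k)) =
   t ^+ 2 * (r * r ^+ k) * (4 * 4 ^+ k) by ring.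
apply: ler_wpM2l.
  by apply: mulr_ge0; [exact: sqr_ge0|rewrite mulr_ge0// exprn_ge0].
by have : (0 : R) <= 4 ^+ k by []; lra.
Qed.

(** Coefficients of the formal partial derivative. *)
Definition dcoef n (i : 'I_n) (c : mnm n -> R) (be : mnm n) : R :=
  (be i).+1%:R * c (mpoly.mnm_add be (mpoly.mnm1 i)).

(** Partial derivative of [monomial] with respect to the [i]-th coordinate. *)
Definition dmonomial n (i : 'I_n) (x : 'rV[R]_n) (al : mnm n) : R :=
  (al i)%:R * x 0 i ^+ (al i).-1 * \prod_(j | j != i) x 0 j ^+ al j.

Lemma geom_bounded_dcoef n (i : 'I_n) (c : mnm n -> R) K C :
  geom_bounded c K C -> geom_bounded (dcoef i c) (K * C) (2 * C).
Proof.
move=> [K0 C0 H]; split; [by rewrite mulr_ge0// ltW|by rewrite mulr_gt0|].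
move=> be; rewrite /dcoef normrM normr_nat.
apply: (@le_trans _ _ (2 ^+ mdeg be * (K * C ^+ (mdeg be).+1))); last first.
  by rewrite exprS exprMn le_eqVlt; apply/orP; left; apply/eqP; ring.
apply: ler_pM => //.
  rewrite -natrX ler_nat; apply: (@leq_trans (2 ^ be i)); first exact: ltn_expl.
  by rewrite leq_exp2l// mpoly.mdegE (bigD1 i) //= leq_addr.
by have := H (mpoly.mnm_add be (mpoly.mnm1 i)); rewrite mpoly.mdegD mpoly.mdeg1 addn1.
Qed.

Lemma sums_dcoef n (i : 'I_n) (c : mnm n -> R) (x : 'rV[R]_n) l :
  sums (fun be => dcoef i c be * monomial x be) l ->
  sums (fun al => c al * dmonomial i x al) l.
Proof.
pose h (be : mnm n) := mpoly.mnm_add be (mpoly.mnm1 i).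
(* Terms with [al i = 0] do not come from a shifted index and have zero derivative. *)
pose g (al : mnm n) :=
  if (0 < al i)%N then Some (mpoly.mnm_sub al (mpoly.mnm1 i)) else None.
move=> H; apply: (@sums_reindex _ _ _ h g).
- move=> be; rewrite /g /h mpoly.mnmDE mpoly.mnm1E eqxx addn1 /=.
  by rewrite mpoly.addmK.
- move=> al; rewrite /g; case: ltnP => //= al0; rewrite /h mpoly.submK//.
  by rewrite mpoly.lep1mP -lt0n.
- move=> al; rewrite /g; case: ltnP => //= al0 _.
  move: al0; rewrite leqn0 => /eqP al0.
  by rewrite /dmonomial al0 !mul0r mulr0.
move: H; congr sums; apply/funext => be; rewrite /dcoef /dmonomial /h.
rewrite mpoly.mnmDE mpoly.mnm1E eqxx addn1 /= /monomial (bigD1 i) //=.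
rewrite (_ : \prod_(j < n | j != i) x 0 j ^+ (mpoly.mnm_add be (mpoly.mnm1 i)) j =
   \prod_(j < n | j != i) x 0 j ^+ be j).
  by ring.
apply: eq_bigr => j ji.
by rewrite mpoly.mnmDE mpoly.mnm1E eq_sym (negbTE ji) addn0.
Qed.

Lemma monomial_quadratic n (i : 'I_n) (x : 'rV[R]_n) (t r : R) (al : mnm n) :
  0 <= r -> `|x| <= r -> `|t *: delta_mx 0 i + x| <= r ->
  r ^+ 2 * `|monomial (t *: delta_mx 0 i + x) al - monomial x al - t * dmonomial i x al|
    <= t ^+ 2 * (4 * r) ^+ mdeg al.
Proof.
move=> r0 xr tr.
have E j : (t *: delta_mx 0 i + x) 0 j = if j == i then x 0 i + t else x 0 j.
  rewrite !mxE eqxx /=; case: eqP => [->|_]; first by rewrite mulr1 addrC.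
  by rewrite mulr0 add0r.
pose P := \prod_(j | j != i) x 0 j ^+ al j.
have -> : monomial (t *: delta_mx 0 i + x) al - monomial x al - t * dmonomial i x al =
   P * ((x 0 i + t) ^+ al i - x 0 i ^+ al i - t * ((al i)%:R * x 0 i ^+ (al i).-1)).
  have Em (y : 'rV[R]_n) : monomial y al = y 0 i ^+ al i * \prod_(j | j != i) y 0 j ^+ al j.
    by rewrite /monomial (bigD1 i).
  rewrite !Em E eqxx /dmonomial -/P.
  rewrite (_ : \prod_(j < n | j != i) (t *: delta_mx 0 i + x) 0 j ^+ al j = P).
    by ring.
  by apply: eq_bigr => j /negbTE ji; rewrite E ji.
rewrite normrM mulrCA.
have q := @expr_quadratic (x 0 i) t r (al i) r0.
have := q _ _; rewrite (le_trans (rv_coord_le _ _) xr).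
have := rv_coord_le (t *: delta_mx 0 i + x) i; rewrite E eqxx => /le_trans -> //.
move=> /(_ isT isT) {}q.
apply: (@le_trans _ _ (\prod_(j | j != i) (4 * r) ^+ al j * (t ^+ 2 * (4 * r) ^+ al i))).
  apply: ler_pM => //; first by rewrite mulr_ge0 ?sqr_ge0.
  rewrite normr_prod; apply: ler_prod => j _; rewrite normr_ge0 normrX /=.
  apply: lerXn2r; rewrite ?nnegrE//; first by rewrite mulr_ge0.
  by apply: le_trans (rv_coord_le _ _) _; apply: le_trans xr _; lra.
rewrite mpoly.mdegE -prodrXr [X in _ <= _ * X](bigD1 i) //=.
by rewrite le_eqVlt; apply/orP; left; apply/eqP; ring.
Qed.

(** The quadratic remainders of the monomials, weighted by the coefficients, are
dominated by a geometric series of ratio [2^-1]: this is where the radius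
[(8 * C)^-1] comes from. *)
Lemma powsum_derive n (i : 'I_n) (c : mnm n -> R) K C (x : 'rV[R]_n) :
  geom_bounded c K C -> 8 * C * `|x| < 1 ->
  is_derive x (delta_mx 0 i) (powsum c) (powsum (dcoef i c) x).
Proof.
move=> g lt1; have [K0 C0 _] := g.
pose r := (8 * C)^-1.
have r0 : 0 < r by rewrite invr_gt0 mulr_gt0.
have Cr : C * r = 8^-1 by rewrite /r; field; lra.
have xr : `|x| < r by rewrite /r -[ltRHS]mul1r ltr_pdivlMr ?mulr_gt0// mulrC.
have C1 (y : 'rV[R]_n) : `|y| <= r -> C * `|y| < 1.
  move=> yr; apply: (@le_lt_trans _ _ (C * r)); last by rewrite Cr; lra.
  by apply: ler_wpM2l => //; exact: ltW.
have g' := geom_bounded_dcoef i g.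
apply: (@is_derive_quad _ _ _ _ _ (r ^- 2 * (K * 2 ^+ n)) (r - `|x|)).
  by rewrite subr_gt0.
move=> t ht.
have dr : `|t *: delta_mx 0 i + x| <= r.
  apply: le_trans (ler_normD _ _) _; rewrite normrZ.
  by have := ler_wpM2l (normr_ge0 t) (delta_norm i); lra.
have S1 := powsumP g (C1 _ dr).
have S2 := powsumP g (C1 _ (ltW xr)).
have lt2 : 2 * C * `|x| < 1.
  have : 0 <= C * `|x| by rewrite mulr_ge0// ltW.
  by lra.
have S3 := sums_dcoef (powsumP g' lt2).
have S := sumsD (sumsD S1 (sumsZ (k := -1) S2)) (sumsZ (k := - t) S3).
rewrite mulN1r mulNr in S.
apply: (sums_norm_le S).
apply: (@bounded_sums_le _ _ _ (fun al => (r ^- 2 * K * t ^+ 2) * 2^-1 ^+ mdeg al)).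
  move=> al; rewrite mulN1r mulNr mulrCA -!mulrBr normrM.
  apply: (@le_trans _ _ (K * C ^+ mdeg al * (r ^- 2 * (t ^+ 2 * (4 * r) ^+ mdeg al)))).
    apply: ler_pM => //; first by case: g.
    rewrite ler_pdivlMl ?exprn_gt0//.
    by apply: monomial_quadratic => //; exact: ltW.
  rewrite (_ : 2^-1 = C * (4 * r)); last by rewrite mulrCA Cr; field.
  rewrite [(C * _) ^+ _]exprMn.
  by rewrite le_eqVlt; apply/orP; left; apply/eqP; ring.
have -> : r ^- 2 * (K * 2 ^+ n) * t ^+ 2 = `|r ^- 2 * K * t ^+ 2| * (1 - 2^-1)^-1 ^+ n.
  rewrite ger0_norm; last first.
    apply: mulr_ge0; last exact: sqr_ge0.
    by apply: mulr_ge0 => //; rewrite invr_ge0 sqr_ge0.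
  by rewrite (_ : (1 - 2^-1)^-1 = 2 :> R); [ring | field].
by apply: bounded_sumsZ; apply: bounded_sums_geometric; lra.
Qed.

(** The partial derivative is again the sum of a power series near each point, so
that the statement can be iterated. *)
Lemma analytic_derive n (U : set 'rV[R]_n) (F : 'rV[R]_n -> R) (i : 'I_n) :
  open U -> analytic_on U F ->
  (forall x, U x -> derivable F x (delta_mx 0 i)) /\
  analytic_on U ('D_(delta_mx 0 i) F).
Proof.
move=> oU aF.
have key x : U x -> exists c K C, geom_bounded c K C /\ \forall y \near x,
    is_derive y (delta_mx 0 i) F (powsum (dcoef i c) (y - x)).
  move=> Ux; have /analytic_atP[c [K [C [g H]]]] := aF x Ux.
  have [K0 C0 _] := g.
  exists c, K, C; split => //.
  have /near_ball_elim[e e0 He] := near_join H.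
  apply: (@near_ball_intro _ _ (Num.min e (8 * C)^-1)).
    by rewrite lt_min e0 invr_gt0 mulr_gt0.
  move=> y; rewrite lt_min => /andP[ye yC].
  have dpsv : is_derive y (delta_mx 0 i) (fun y => powsum c (y - x))
      (powsum (dcoef i c) (y - x)).
    have lt1 : 8 * C * `|y - x| < 1 by rewrite mulrC -ltr_pdivlMr ?mulr_gt0// mul1r.
    have [d1 d2] := powsum_derive i g lt1.
    pose G := fun y => powsum c (y - x).
    have E : (fun h : R => h^-1 *: ((G \o shift y) (h *: delta_mx 0 i) - G y)) =
        (fun h : R => h^-1 *: ((powsum c \o shift (y - x)) (h *: delta_mx 0 i)
          - powsum c (y - x))).
      by apply/funext => h; rewrite /G /= addrA.
    split; first by rewrite /derivable -/G E.
    by rewrite -d2 /derive -/G E.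
  apply: near_eq_is_derive dpsv.
  have := He y ye; apply: filterS => z Hz; by rewrite Hz.
split.
  by move=> x /key[c [K [C [g /nbhs_singleton[]]]]].
move=> x /key[c [K [C [g H]]]].
apply/analytic_atP; exists (dcoef i c), (K * C), (2 * C); split.
  exact: geom_bounded_dcoef.
by apply: filterS H => y [_ <-].
Qed.

Lemma analytic_smooth n (U : set 'rV[R]_n) (F : 'rV[R]_n -> R) :
  open U -> analytic_on U F -> smooth_on U F.
Proof.
move=> oU aF s.
have : analytic_on U (partials s F).
  by elim: s => [//|i s IH] /=; exact: (proj2 (analytic_derive i oU IH)).
move=> as_ x Ux; split; first exact: analytic_continuous (as_ x Ux).
by move=> i; exact: (proj1 (analytic_derive i oU as_)).
Qed.

End AnalyticSmooth.

(** * Analytic functions of one variable along polynomial arcs *)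

Section OneVariable.
Context {R : realType}.

Lemma horner_le1 (p : {poly R}) (t : R) : `|t| <= 1 ->
  `|p.[t]| <= \sum_(i < size p) `|p`_i|.
Proof.
move=> t1; rewrite horner_coef; apply: le_trans (ler_norm_sum _ _ _) _.
apply: ler_sum => i _; rewrite normrM normrX -[leRHS]mulr1.
by apply: ler_wpM2l => //; apply: exprn_ile1.
Qed.

Lemma small_eq0 (x B : R) :
  (forall e : R, 0 < e -> exists2 t : R, `|t| < e & `|x| <= B * `|t|) ->
  x = 0.
Proof.
move=> H; apply/eqP; rewrite -normr_le0; apply/ler_addgt0Pr => e e0.
rewrite add0r.
have B0 : 0 < `|B| + 1 by have := normr_ge0 B; lra.
have [|t te /le_trans ->//] := H (e / (`|B| + 1)); first by rewrite divr_gt0.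
have := te; rewrite ltr_pdivlMr// => te'.
have h : B * `|t| <= (`|B| + 1) * `|t|.
  by apply: ler_wpM2r => //; have := ler_norm B; lra.
by rewrite (le_trans h)// mulrC ltW.
Qed.

(** The smallness is assumed at nonzero points accumulating at [0], to serve both for
Taylor remainders and for accumulating zeros. *)
Lemma polyO_coef0 (p : {poly R}) (K : R) (N : nat) :
  (forall e, 0 < e -> exists t, [/\ 0 < `|t|, `|t| < e & `|p.[t]| <= K * `|t| ^+ N]) ->
  forall j, (j < N)%N -> p`_j = 0.
Proof.
move=> H j; elim/ltn_ind: j => j IH jN.
pose p1 := drop_poly j p; pose p2 := drop_poly 1 p1.
have pE : p = p1 * 'X^j.
  rewrite -[LHS](poly_take_drop j) [take_poly _ _](_ : _ = 0) ?add0r//.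
  apply/polyP => i; rewrite coef_take_poly coef0; case: ltnP => // ij.
  by apply: IH => //; exact: ltn_trans ij jN.
have p1E : p1 = p2 * 'X + (p`_j)%:P.
  apply/polyP => i; rewrite coefD coefMX coefC !coef_drop_poly.
  by case: i => [|i] /=; rewrite ?add0r ?addr0 ?addn1 ?addn0 ?add0n.
pose S := \sum_(i < size p2) `|p2`_i|.
apply: (@small_eq0 _ (`|K| + S)) => e e0.
have [|t [t0 te Ht]] := H (Num.min e 1); first by rewrite lt_min e0 ltr01.
move: te; rewrite lt_min => /andP[te t1]; exists t => //.
have h1 : `|p1.[t]| <= `|K| * `|t|.
  have : `|p1.[t]| * `|t| ^+ j <= `|K| * `|t| * `|t| ^+ j.
    have <- : `|p.[t]| = `|p1.[t]| * `|t| ^+ j.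
      by rewrite [in LHS]pE hornerM hornerXn normrM normrX.
    apply: (le_trans Ht); apply: (@le_trans _ _ (`|K| * `|t| ^+ N)).
      by apply: ler_wpM2r; [exact: exprn_ge0|exact: ler_norm].
    rewrite -mulrA -exprS; apply: ler_wpM2l => //.
    by apply: ler_wiXn2l => //; exact: ltW.
  by rewrite ler_pM2r// exprn_gt0.
have h2 := horner_le1 p2 (ltW t1).
have -> : p`_j = p1.[t] - p2.[t] * t.
  by rewrite p1E !hornerE; ring.
apply: le_trans (ler_normB _ _) _; rewrite mulrDl normrM; apply: lerD => //.
by apply: ler_wpM2r.
Qed.

(** Analyticity at [t0], as geometric control of every Taylor remainder: equality of
coefficients can then be read off from orders of vanishing. *)
Definition expansion (g : R -> R) (t0 : R) (a : nat -> R) (C : R) : Prop :=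
  0 < C /\ forall N t, C * `|t| < 1 ->
    `|g (t0 + t) - \sum_(k < N) a k * t ^+ k| <= C * (C * `|t|) ^+ N.

Definition expandable (g : R -> R) (t0 : R) : Prop := exists a C, expansion g t0 a C.

Lemma expandable_shift (g : R -> R) (t0 : R) :
  expandable (fun t => g (t0 + t)) 0 -> expandable g t0.
Proof.
move=> [a [C [C0 H]]]; exists a, C; split=> // N t /(H N).
by rewrite add0r.
Qed.

Lemma expandableB (g h : R -> R) (t0 : R) :
  expandable g t0 -> expandable h t0 -> expandable (fun t => g t - h t) t0.
Proof.
move=> [a [C [C0 H]]] [b [D [D0 H']]]; exists (fun k => a k - b k), (C + D).
split; first exact: addr_gt0.
move=> N t lt1.
have Ct : 0 <= C * `|t| by rewrite mulr_ge0// ltW.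
have Dt : 0 <= D * `|t| by rewrite mulr_ge0// ltW.
have Hg : C * `|t| < 1 by lra.
have Hh : D * `|t| < 1 by lra.
have -> : g (t0 + t) - h (t0 + t) - \sum_(k < N) (a k - b k) * t ^+ k =
   (g (t0 + t) - \sum_(k < N) a k * t ^+ k) -
   (h (t0 + t) - \sum_(k < N) b k * t ^+ k).
  rewrite (eq_bigr (fun k : 'I_N => a k * t ^+ k - b k * t ^+ k)); last first.
    by move=> k _; rewrite mulrBl.
  by rewrite sumrB; ring.
apply: le_trans (ler_normB _ _) _; rewrite mulrDl; apply: lerD.
  apply: le_trans (H N t Hg) _; apply: ler_wpM2l; first exact: ltW.
  by apply: lerXn2r; rewrite ?nnegrE; lra.
apply: le_trans (H' N t Hh) _; apply: ler_wpM2l; first exact: ltW.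
by apply: lerXn2r; rewrite ?nnegrE; lra.
Qed.

Lemma expansion_coef_le (g : R -> R) t0 a C : expansion g t0 a C ->
  forall k, `|a k| <= 2 * C * C ^+ k.
Proof.
move=> [C0 H] k.
pose t := (2 * C)^-1.
have t0' : 0 < t by rewrite invr_gt0 mulr_gt0.
have Ct : C * t = 2^-1 by rewrite /t; field; lra.
have lt1 : C * `|t| < 1 by rewrite gtr0_norm// Ct; lra.
have h1 := H k t lt1; have h2 := H k.+1 t lt1.
rewrite -(ler_pM2r (exprn_gt0 k t0')).
rewrite (_ : 2 * C * C ^+ k * t ^+ k = 2 * C * (C * t) ^+ k); last first.
  by rewrite exprMn mulrA.
have -> : `|a k| * t ^+ k = `|(g (t0 + t) - \sum_(i < k) a i * t ^+ i) -
   (g (t0 + t) - \sum_(i < k.+1) a i * t ^+ i)|.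
  rewrite big_ord_recr /=; set u := \sum_(i < k) _.
  rewrite (_ : _ - _ = a k * t ^+ k); last by ring.
  by rewrite normrM normrX (gtr0_norm t0').
apply: le_trans (ler_normB _ _) _.
apply: le_trans (lerD h1 h2) _; rewrite (gtr0_norm t0').
have : (C * t) ^+ k.+1 <= (C * t) ^+ k.
  by apply: ler_wiXn2l => //; rewrite Ct; lra.
rewrite -(ler_pM2l C0); lra.
Qed.

Lemma expansion_coef0 (g : R -> R) t0 a C : expansion g t0 a C -> (forall k, a k = 0) ->
  exists2 e, 0 < e & forall t, `|t| < e -> g (t0 + t) = 0.
Proof.
move=> [C0 H] a0; exists C^-1; rewrite ?invr_gt0// => t tC.
have lt1 : C * `|t| < 1 by rewrite mulrC -ltr_pdivlMr// mul1r.
apply/eqP; rewrite -normr_le0.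
have cv : (C * (C * `|t|) ^+ N) @[N --> \oo] --> (C * 0 : R).
  apply: cvgMl_tmp; apply: cvg_expr.
  by rewrite ger0_norm// mulr_ge0// ltW.
rewrite mulr0 in cv.
apply: (ler_cvg_to (cvg_cst (`|g (t0 + t)|)) cv) => //.
near=> N.
have := H N t lt1; rewrite big1 ?subr0// => k _; by rewrite a0 mul0r.
Unshelve. all: by end_near. Qed.

(** Isolated zeros: if zeros accumulate at [t0], all coefficients vanish. *)
Lemma expandable_zero_limit (g : R -> R) t0 :
  expandable g t0 ->
  (forall e, 0 < e -> exists t, [/\ 0 < `|t|, `|t| < e & g (t0 + t) = 0]) ->
  exists2 e, 0 < e & forall t, `|t| < e -> g (t0 + t) = 0.
Proof.
move=> [a [C [C0 H]]] Hz.
have a0 k : a k = 0.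
  pose p := \poly_(i < k.+1) a i.
  have -> : a k = p`_k by rewrite coef_poly ltnSn.
  apply: (@polyO_coef0 p (C * C ^+ k.+1) k.+1) => // e e0.
  have [|t [t0_ te gt]] := Hz (Num.min e C^-1); first by rewrite lt_min e0 invr_gt0.
  move: te; rewrite lt_min => /andP[te tC]; exists t; split=> //.
  have lt1 : C * `|t| < 1 by rewrite mulrC -ltr_pdivlMr// mul1r.
  have := H k.+1 t lt1; rewrite gt sub0r normrN exprMn mulrA.
  by rewrite horner_poly.
by apply: expansion_coef0 a0; split; [exact: C0|exact: H].
Qed.

(** The points near which [g] vanishes form a set that is open, and closed by
[expandable_zero_limit], in the connected interval. *)
Lemma expandable_identity (g : R -> R) (b : R) :
  (forall t, 0 <= t <= b -> expandable g t) ->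
  (exists2 e, 0 < e & forall t, `|t| < e -> g t = 0) ->
  forall t, 0 <= t <= b -> g t = 0.
Proof.
move=> Hg [e0 e00 He0] t /andP[t0 tb].
pose Z := [set s : R | \forall u \near s, g u = 0].
have Zo : open Z.
  rewrite openE => s Zs; exact: (near_join Zs).
have conn : connected `[0, b]%classic by apply: segment_connected.
have ZB : `[0, b]%classic `&` Z = `[0, b]%classic.
  apply: conn.
  - exists 0; split; first by rewrite /= in_itv /= lexx (le_trans t0 tb).
    apply/nbhs_ballP; exists e0 => // s; rewrite -ball_normE /= sub0r normrN.
    exact: He0.
  - by exists Z.
  exists (closure Z); first exact: closed_closure.
  apply/seteqP; split=> [s [sb Zs]|s [sb Zs]]; split => //.
    exact: subset_closure.
  have [e1 e10 He1] : exists2 e, 0 < e & forall t, `|t| < e -> g (s + t) = 0.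
    apply: expandable_zero_limit; first by apply: Hg; move: sb; rewrite /= in_itv.
    move=> e1 e10.
    have [u [Zu us]] := Zs _ (nbhsx_ballx s e1 e10).
    have [d d0 Hd] : exists2 d, 0 < d & forall v, `|u - v| < d -> g v = 0.
      by move: Zu => /nbhs_ballP[d /= d0 Hd]; exists d => // v uv;
        apply: Hd; rewrite -ball_normE.
    move: us; rewrite -ball_normE /= => us.
    (* If [u] is [s] itself, a nearby point is a zero different from [s]. *)
    have [E|/eqP E] := eqVneq u s.
      pose m := Num.min d e1 / 2.
      have m0 : 0 < m by rewrite divr_gt0// lt_min d0 e10.
      have mm : m < Num.min d e1 by move: m0; rewrite /m; lra.
      move: (mm); rewrite lt_min => /andP[md me].
      exists m; rewrite (gtr0_norm m0); split => //; apply: Hd.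
      by rewrite E opprD addrA subrr sub0r normrN gtr0_norm.
    exists (u - s); split; first by rewrite normr_gt0 subr_eq0; apply/eqP.
      by rewrite distrC.
    by rewrite (_ : s + (u - s) = u); [exact: nbhs_singleton Zu|ring].
  apply/nbhs_ballP; exists e1 => // v; rewrite -ball_normE /= => sv.
  by rewrite (_ : v = s + (v - s)); [apply: He1; rewrite distrC|ring].
have : (`[0, b]%classic `&` Z) t by rewrite ZB /= in_itv /= t0.
by case=> _ /nbhs_singleton.
Qed.

Lemma expansion_coef_poly (g : R -> R) t0 a C (q : {poly R}) (N : nat) (K e : R) :
  expansion g t0 a C -> 0 < e ->
  (forall t, `|t| < e -> `|g (t0 + t) - q.[t]| <= K * `|t| ^+ N) ->
  forall j, (j < N)%N -> a j = q`_j.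
Proof.
move=> [C0 H] e0 Hq j jN; apply/eqP; rewrite -subr_eq0; apply/eqP.
pose p := \poly_(i < N) a i - q.
have -> : a j - q`_j = p`_j by rewrite coefB coef_poly jN.
apply: (@polyO_coef0 p (C * C ^+ N + K) N) => // d d0.
pose m := Num.min d (Num.min e C^-1) / 2.
have m0 : 0 < m by rewrite divr_gt0// !lt_min d0 e0 invr_gt0.
have : m < Num.min d (Num.min e C^-1) by move: m0; rewrite /m; lra.
rewrite !lt_min => /and3P[md me mC].
exists m; rewrite (gtr0_norm m0); split=> //.
have := Hq m; rewrite (gtr0_norm m0) => /(_ me) h1.
have := H N m; rewrite (gtr0_norm m0) => /(_ _) h2.
have {}h2 := h2 _; have lt1 : C * m < 1 by rewrite mulrC -ltr_pdivlMr// mul1r.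
move: h2 => /(_ lt1) h2.
rewrite /p !hornerE horner_poly.
have -> : \sum_(i < N) a i * m ^+ i - q.[m] =
  (g (t0 + m) - q.[m]) - (g (t0 + m) - \sum_(i < N) a i * m ^+ i) by ring.
apply: le_trans (ler_normB _ _) _; rewrite mulrDl addrC; apply: lerD => //.
by apply: le_trans h2 _; rewrite exprMn mulrA.
Qed.

Lemma expandable_flat (g : R -> R) t0 :
  expandable g t0 ->
  (forall N, exists K e, 0 < e /\ forall t, `|t| < e -> `|g (t0 + t)| <= K * `|t| ^+ N) ->
  exists2 e, 0 < e & forall t, `|t| < e -> g (t0 + t) = 0.
Proof.
move=> [a [C H]] flat; apply: (expansion_coef0 H) => k.
have [K [e [e0 He]]] := flat k.+1.
rewrite (expansion_coef_poly (q := 0) (N := k.+1) (K := K) H e0 _ (ltnSn k)) ?coef0//.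
by move=> t te; rewrite horner0 subr0; exact: He.
Qed.

Lemma partial_powsum_1var (c : mnm 1 -> R) (N : nat) (t : R) :
  partial_powsum c N (const_mx t) =
  \sum_(k < N) c (mpoly.Multinom [tuple (k : nat) | _ < 1]) * t ^+ k.
Proof.
have deg (al : mnm 1) : mdeg al = al ord0 by rewrite mpoly.mdegE big_ord1.
have hP (k : 'I_N) : (mdeg (mpoly.Multinom [tuple (k : nat) | _ < 1]) < N)%N.
  by rewrite deg mpoly.mnmE.
pose h (k : 'I_N) := mpoly.BMultinom (hP k).
pose h' (al : mpoly.bmultinom 1 N) := Ordinal (mpoly.bmdeg al).
rewrite /partial_powsum (reindex h) /=.
  apply: eq_bigr => k _; congr (_ * _).
  by rewrite /monomial big_ord1 mxE mpoly.mnmE.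
exists h' => [k _|al _]; apply: val_inj => /=.
  by rewrite deg mpoly.mnmE.
by apply/mpoly.mnmP => i; rewrite mpoly.mnmE deg (ord1 i).
Qed.

Lemma analytic_expandable (G : 'rV[R]_1 -> R) :
  analytic_at G 0 -> expandable (fun t => G (const_mx t)) 0.
Proof.
move=> /analytic_atP[c [K [C [g /near_ball_elim[e e0 He]]]]]; have [K0 C0 _] := g.
exists (fun k => c (mpoly.Multinom [tuple (k : nat) | _ < 1])), (2 * C + 2 * K + e^-1).
have e'0 : 0 < e^-1 by rewrite invr_gt0.
split; first lra.
move=> N t lt1; rewrite add0r.
have [h1 h2 h3] : [/\ 2 * C * `|t| <= 1, 0 <= 2 * C * `|t| & `|t| < e].
  have a1 : 0 <= C * `|t| by rewrite mulr_ge0// ltW.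
  have a2 : 0 <= K * `|t| by rewrite mulr_ge0.
  have a3 : 0 <= e^-1 * `|t| by rewrite mulr_ge0// ltW.
  split; [lra|lra|].
  by rewrite -[ltRHS]mulr1 -ltr_pdivrMl//; lra.
have nt : `|(const_mx t : 'rV[R]_1)| = `|t|.
  apply/eqP; rewrite eq_le; apply/andP; split.
    by apply: rv_norm_le => // i; rewrite mxE.
  by apply: le_trans (rv_coord_le _ ord0); rewrite mxE.
rewrite He ?subr0 ?nt// -partial_powsum_1var.
apply: le_trans (powsum_remainder N g _) _; rewrite nt//.
rewrite expr1; apply: ler_pM; rewrite ?exprn_ge0//; [lra|lra|].
apply: lerXn2r; rewrite ?nnegrE//.
  by rewrite mulr_ge0//; lra.
by apply: ler_wpM2r => //; lra.
Qed.

(** Plots are families of multivariate polynomials, here in a single variable, whereas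
the arcs of a cusp are curves with components in [{poly R}]. *)
Definition mpoly_of_poly (q : {poly R}) : mpoly.mpoly 1 R :=
  \sum_(k < size q) q`_k *: mpoly.mpolyX R (mpoly.mnm_muln (mpoly.mnm1 ord0) k).

Lemma meval_mpoly_of_poly (q : {poly R}) (v : 'I_1 -> R) :
  mpoly.meval v (mpoly_of_poly q) = q.[v ord0].
Proof.
rewrite /mpoly_of_poly raddf_sum horner_coef; apply: eq_bigr => k _ /=.
rewrite mpoly.mevalZ mpoly.mevalX big_ord1; congr (_ * _ ^+ _).
by rewrite mpoly.mulmnE mpoly.mnm1E eqxx mul1n.
Qed.

Lemma polymap_of_poly n (h : 'I_n -> {poly R}) (t : 'rV[R]_1) :
  polymap (fun i => mpoly_of_poly (h i)) t = polycurve h (t 0 0).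
Proof. by apply/rowP => i; rewrite !mxE meval_mpoly_of_poly. Qed.

(** Shift the parameter to bring [t0] to [0]. *)
Lemma analytic_curve n (F : 'rV[R]_n -> R) (h : 'I_n -> {poly R}) (t0 : R) :
  analytic_at F (polycurve h t0) -> expandable (fun t => F (polycurve h t)) t0.
Proof.
move=> aF; apply: expandable_shift.
pose h' i := h i \Po ('X + t0%:P).
have hE t : polycurve h' t = polycurve h (t0 + t).
  by apply/rowP => i; rewrite !mxE horner_comp !hornerE addrC.
have := @analytic_at_comp R n 1 F (fun i => mpoly_of_poly (h' i)).
rewrite polymap_of_poly mxE hE addr0 => /(_ aF) /analytic_expandable.
by congr expandable; apply/funext => t; rewrite polymap_of_poly mxE hE.
Qed.

Definition arc_analytic n (X : set 'rV[R]_n) (F : 'rV[R]_n -> R) : Prop :=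
  forall (h : 'I_n -> {poly R}) (t0 : R),
  (exists2 e, 0 < e & forall t, `|t - t0| < e -> X (polycurve h t)) ->
  expandable (fun t => F (polycurve h t)) t0.

(** The arc has some degree, and [Comega] covers all degrees; near [t0] the function [F]
along the arc coincides with the germ that [Comega] provides. *)
Lemma Comega_arc_analytic n (X : set 'rV[R]_n) (f : X -> R) (F : 'rV[R]_n -> R) :
  Comega 1 X f -> (forall x : X, F (\val x) = f x) -> arc_analytic X F.
Proof.
move=> Cf Ff h t0 [e e0 He]; apply: expandable_shift.
pose h' i := h i \Po ('X + t0%:P).
have hE t : polycurve h' t = polycurve h (t0 + t).
  by apply/rowP => i; rewrite !mxE horner_comp !hornerE addrC.
pose p i := mpoly_of_poly (h' i).
pose d := (\sum_i mpoly.mmeasure (@mpoly.mdeg 1) (p i)).+1.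
have pE t : polymap p t = polycurve h (t0 + t 0 0) by rewrite polymap_of_poly hE.
have nX : \forall t \near (0 : 'rV[R]_1), X (polymap p t).
  apply: (near_ball_intro e0) => t; rewrite subr0 => te; rewrite pE; apply: He.
  by rewrite addrAC subrr add0r (le_lt_trans (rv_coord_le _ _) te).
have pp : plot d X p.
  split=> // i; rewrite /d (bigD1 i) //=.
  by rewrite -addnS -addnS leq_addr.
have [g [ag Hg]] := Cf d isT p pp.
have : analytic_at (fun t => F (polymap p t)) 0.
  have /analytic_atP[c [K [C [gc H]]]] := ag.
  apply/analytic_atP; exists c, K, C; split=> //.
  near=> t; have <- : g t = powsum c (t - 0) by near: t.
  have Xt : X (polymap p t) by near: t.
  have Hgt : forall x : X, \val x = polymap p t -> g t = f x by near: t.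
  by rewrite (Hgt (exist (fun x => x \in X) _ (mem_set Xt)))// -Ff.
move=> /analytic_expandable; congr expandable; apply/funext => t.
by rewrite pE mxE.
Unshelve. all: by end_near. Qed.

End OneVariable.

(** * Taylor expansion of smooth functions *)

Section Taylor.
Context {R : realType}.

Lemma mvt_bound (f df : R -> R) (a b B : R) :
  (forall x, `|x - a| <= `|b - a| -> is_derive x 1 f (df x) /\ `|df x| <= B) ->
  `|f b - f a| <= B * `|b - a|.
Proof.
have key (c d : R) : c <= d ->
    (forall x : R, c <= x <= d -> is_derive x 1 f (df x) /\ `|df x| <= B) ->
    `|f d - f c| <= B * `|d - c|.
  move=> cd H.
  have [||x] := @MVT_segment R f df c d cd.
  - by move=> x; rewrite in_itv /= => /andP[/ltW cx /ltW xd]; have [] := H x; rewrite ?cx.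
  - apply: derivable_within_continuous => x; rewrite in_itv /= => /H[[]] //.
  by rewrite in_itv /= => /H[_ dB] ->; rewrite normrM ler_wpM2r.
move=> H; have [ab|/ltW ba] := leP a b.
  apply: key => // x /andP[ax xb]; apply: H.
  by rewrite !ger0_norm ?subr_ge0//; lra.
rewrite distrC [X in _ * X]distrC; apply: key => // x /andP[ax xb]; apply: H.
by rewrite !ler0_norm ?subr_le0//; lra.
Qed.

Lemma is_derive_line n (F : 'rV[R]_n -> R) (x v : 'rV[R]_n) (s l : R) :
  is_derive (x + s *: v) v F l -> is_derive s 1 (fun s => F (x + s *: v)) l.
Proof.
move=> [d1 d2].
pose G := fun s => F (x + s *: v).
have E : (fun h : R => h^-1 *: ((G \o shift s) (h *: 1) - G s)) =
    (fun h : R => h^-1 *: ((F \o shift (x + s *: v)) (h *: v) - F (x + s *: v))).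
  apply/funext => h; rewrite /G /=; congr (_ *: (F _ - _)).
  rewrite (_ : h *: 1 = h); last by rewrite /GRing.scale /= mulr1.
  by rewrite scalerDl addrCA.
split; first by rewrite /derivable -/G E.
by rewrite -d2 /derive -/G E.
Qed.

Lemma partials_rcons n (s : seq 'I_n) i (F : 'rV[R]_n -> R) :
  partials (rcons s i) F = partials s ('D_(delta_mx 0 i) F).
Proof. by elim: s => //= j s ->. Qed.

Lemma smooth_on_D n (U : set 'rV[R]_n) (F : 'rV[R]_n -> R) i :
  smooth_on U F -> smooth_on U ('D_(delta_mx 0 i) F).
Proof. by move=> H s; rewrite -partials_rcons; exact: H. Qed.

Lemma continuous_eps n (F : 'rV[R]_n -> R) (a : 'rV[R]_n) :
  {for a, continuous F} -> forall e, 0 < e -> exists2 d : R, 0 < d &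
   forall x, `|x - a| < d -> `|F x - F a| <= e.
Proof.
move=> /(@cvgrPdist_le _ _ _ (nbhs (a : 'rV[R]_n)) _) H e /H /near_ball_elim[d d0 Hd].
by exists d => // x /Hd; rewrite distrC.
Qed.

(** Differentiability of a function with continuous partial derivatives: move from [x]
to [x + h] one coordinate at a time and apply the mean value inequality to each
step. *)
Lemma smooth_diff n (U : set 'rV[R]_n) (F : 'rV[R]_n -> R) (x : 'rV[R]_n) :
  open U -> smooth_on U F -> U x ->
  forall e, 0 < e -> exists2 d : R, 0 < d &
   forall h : 'rV[R]_n, `|h| < d ->
    `|F (x + h) - F x - \sum_i h 0 i * 'D_(delta_mx 0 i) F x| <= e * `|h|.
Proof.
move=> oU sF Ux e e0.
pose D i := 'D_(delta_mx 0 i) F.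
have n0 : 0 < (n.+1%:R : R) by [].
have [dU dU0 HU] := near_ball_elim (open_nbhs_nbhs (conj oU Ux)).
have /choice[dl Hdl] (i : 'I_n) : exists d : R, 0 < d /\
    forall y, `|y - x| < d -> `|D i y - D i x| <= e / n.+1%:R.
  have cD : {for x, continuous (D i)} by have [] := sF [:: i] x Ux.
  have en : 0 < e / n.+1%:R by exact: divr_gt0.
  by have [d d0 Hd] := continuous_eps cD en; exists d.
pose d := \big[Num.min/dU]_i dl i.
have d0 : 0 < d by apply/bigmin_gtP; split => // i _; have [] := Hdl i.
exists d => // h hd.
(* [p k] has the first [k] coordinates of [h] and zeros elsewhere. *)
pose p (k : nat) : 'rV[R]_n := \row_i (if (i < k)%N then h 0 i else 0).
have pE (k : 'I_n) : p k.+1 = p k + h 0 k *: delta_mx 0 k.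
  apply/rowP => j; rewrite !mxE eqxx /= ltnS leq_eqVlt.
  case: (eqVneq j k) => [->|jk]; first by rewrite eqxx ltnn /= add0r mulr1.
  have /negbTE -> : (j != k :> nat) by [].
  by rewrite mulr0 addr0.
have p0 : p 0 = 0 by apply/rowP => j; rewrite !mxE.
have pn : p n = h by apply/rowP => j; rewrite !mxE ltn_ord.
have -> : F (x + h) - F x = \sum_(k < n) (F (x + p k.+1) - F (x + p k)).
  rewrite -(big_mkord xpredT (fun k => F (x + p k.+1) - F (x + p k))).
  by rewrite telescope_sumr// pn p0 addr0.
rewrite -sumrB; apply: le_trans (ler_norm_sum _ _ _) _.
apply: (@le_trans _ _ (\sum_(k < n) e / n.+1%:R * `|h|)); last first.
  rewrite sumr_const card_ord -[_ *+ n]mulr_natl mulrA; apply: ler_wpM2r => //.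
  rewrite mulrCA ger_pMr// ler_pdivrMr// mul1r.
  by rewrite ler_nat.
apply: ler_sum => k _.
pose f s := F (x + p k + s *: delta_mx 0 k) - s * D k x.
pose df s := D k (x + p k + s *: delta_mx 0 k) - D k x.
have -> : F (x + p k.+1) - F (x + p k) - h 0 k * 'D_(delta_mx 0 k) F x =
   f (h 0 k) - f 0.
  rewrite /f scale0r addr0 mul0r subr0 (_ : x + p k.+1 = x + p k + h 0 k *: delta_mx 0 k).
    by rewrite /D; ring.
  by rewrite pE addrA.
apply: (@le_trans _ _ (e / n.+1%:R * `|h 0 k - 0|)); last first.
  by rewrite subr0; apply: ler_wpM2l; [rewrite divr_ge0// ltW|exact: rv_coord_le].
apply: (@mvt_bound f df) => s; rewrite !subr0 => sh.
pose y := x + p k + s *: delta_mx 0 k.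
have yd : `|y - x| < d.
  apply: le_lt_trans hd; rewrite /y -[x + _ + _]addrA addrAC subrr add0r.
  apply: rv_norm_le => // j; rewrite !mxE eqxx /=.
  case: (eqVneq j k) => [->|jk].
    by rewrite ltnn mulr1 add0r (le_trans sh)// rv_coord_le.
  by rewrite mulr0 addr0; case: ifP => _; rewrite ?normr0// rv_coord_le.
have Uy : U y by apply: HU; apply: lt_le_trans yd _; exact: bigmin_le_id.
split; last first.
  have [_ H] := Hdl k; apply: H; apply: lt_le_trans yd _; exact: bigmin_le.
apply: is_deriveB.
  apply: is_derive_line; apply: derivableP.
  by have [_ H] := sF [::] y Uy; exact: H.
rewrite -[X in is_derive _ _ _ X](_ : 1 *: D k x = _); last by rewrite scale1r.
have -> : (fun x0 : R => x0 * D k x) = (D k x) \*: id.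
  by apply/funext => u /=; rewrite mulrC.
apply: is_derive_eq.
by rewrite /GRing.scale /= mulrC.
Qed.

Lemma chain_line n (U : set 'rV[R]_n) (F : 'rV[R]_n -> R) (z y : 'rV[R]_n) (s : R) :
  open U -> smooth_on U F -> U (z + s *: y) ->
  is_derive s 1 (fun s => F (z + s *: y))
    (\sum_i y 0 i * 'D_(delta_mx 0 i) F (z + s *: y)).
Proof.
move=> oU sF Uz; apply: is_derive_line; apply: is_derive_eps => e e0.
have y0 : 0 < `|y| + 1 by have := normr_ge0 y; lra.
have [|d d0 Hd] := smooth_diff oU sF Uz (e := e / (`|y| + 1)).
  by rewrite divr_gt0.
exists (d / (`|y| + 1)); first by rewrite divr_gt0.
move=> t; rewrite ltr_pdivlMr// => td.
have ty : `|t *: y| <= `|t| * (`|y| + 1).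
  by rewrite normrZ; apply: ler_wpM2l => //; lra.
have := Hd (t *: y) (le_lt_trans ty td).
rewrite [z + s *: y + t *: y]addrC.
have -> : \sum_i (t *: y) 0 i * 'D_(delta_mx 0 i) F (z + s *: y) =
    t * \sum_i y 0 i * 'D_(delta_mx 0 i) F (z + s *: y).
  by rewrite mulr_sumr; apply: eq_bigr => i _; rewrite !mxE mulrA.
move=> /le_trans; apply; rewrite mulrAC ler_pdivrMr// -mulrA ler_wpM2l// ltW//.
Qed.

(** The homogeneous Taylor polynomial of degree [k] at [z], obtained from those of the
partial derivatives by Euler's identity; this form avoids the symmetry of
higher derivatives. *)
Fixpoint taylor_part n (k : nat) (F : 'rV[R]_n -> R) (z : 'rV[R]_n) : mpoly.mpoly n R :=
  if k is k'.+1 then k'.+1%:R^-1 *: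
    \sum_i mpoly.mpolyX R (mpoly.mnm1 i) * taylor_part k' ('D_(delta_mx 0 i) F) z
  else mpoly.mpolyC n (F z).

Lemma taylor_part_homog n k (F : 'rV[R]_n -> R) z (m : mnm n) : mdeg m != k ->
  mpoly.mcoeff m (taylor_part k F z) = 0.
Proof.
suff H : taylor_part k F z \is (@mpoly.ishomog1 n R k mdeg).
  by move=> mk; exact: mpoly.dhomog_nemf_coeff H mk.
elim: k F => [|k IH] F /=.
  rewrite -[mpoly.mpolyC n _]mulr1 mpoly.mul_mpolyC.
  by apply: mpoly.dhomogZ; exact: mpoly.dhomog1.
apply: mpoly.dhomogZ; apply: rpred_sum => i _.
apply: (mpoly.dhomogM (d := 1) (e := k)); last exact: IH.
by rewrite mpoly.dhomogX; apply/eqP; exact: mpoly.mdeg1.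
Qed.

Lemma taylor_part_scale n k (F : 'rV[R]_n -> R) z (y : 'rV[R]_n) (s : R) :
  mpoly.meval ((s *: y) 0) (taylor_part k F z) =
  s ^+ k * mpoly.meval (y 0) (taylor_part k F z).
Proof.
elim: k F => [|k IH] F /=; first by rewrite !mpoly.mevalC expr0 mul1r.
rewrite !mpoly.mevalZ mulrCA; congr (_ * _).
rewrite !raddf_sum mulr_sumr; apply: eq_bigr => i _ /=.
by rewrite !mpoly.mevalM !mpoly.mevalXU IH mxE exprS; ring.
Qed.

(** Induction on [N], for all smooth functions at once: along the segment from [z] to
[z + y] the derivative of the remainder of [F] is a combination of remainders
of the partial derivatives of [F], by Euler's identity. *)
Lemma taylor_smooth n (U : set 'rV[R]_n) (z : 'rV[R]_n) (N : nat) (F : 'rV[R]_n -> R) :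
  open U -> U z -> smooth_on U F ->
  exists K e, [/\ 0 <= K, 0 < e & forall y, `|y| < e ->
    `|F (z + y) - \sum_(k < N) mpoly.meval (y 0) (taylor_part k F z)| <= K * `|y| ^+ N].
Proof.
move=> oU Uz; elim: N F => [|N IH] F sF.
  have cF : {for z, continuous F} by have [] := sF [::] z Uz.
  have [d d0 Hd] := continuous_eps cF ltr01.
  exists (`|F z| + 1), d; split=> //.
  move=> y yd; rewrite big_ord0 subr0 expr0 mulr1.
  have := Hd (z + y); rewrite addrAC subrr add0r => /(_ yd) h.
  rewrite -[F (z + y)](subrK (F z)) addrC.
  by apply: le_trans (ler_normD _ _) _; rewrite lerD2l.
have /choice[K HK] (i : 'I_n) : exists K, exists e, [/\ 0 <= K, 0 < e &
    forall y, `|y| < e ->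
    `|'D_(delta_mx 0 i) F (z + y) -
      \sum_(k < N) mpoly.meval (y 0) (taylor_part k ('D_(delta_mx 0 i) F) z)|
    <= K * `|y| ^+ N].
  have [K [e H]] := IH _ (@smooth_on_D n U F i sF); by exists K, e.
have /choice[r Hr] := HK.
have [dU dU0 HU] := near_ball_elim (open_nbhs_nbhs (conj oU Uz)).
pose e := \big[Num.min/dU]_i r i.
have e0 : 0 < e by apply/bigmin_gtP; split => // i _; have [] := Hr i.
exists (\sum_i K i), e; split => //.
  by apply: sumr_ge0 => i _; have [] := Hr i.
move=> y ye.
pose q := \poly_(k < N.+1) mpoly.meval (y 0) (taylor_part k F z).
have dq s : q^`().[s] =
   \sum_i y 0 i * \sum_(k < N)
     mpoly.meval ((s *: y) 0) (taylor_part k ('D_(delta_mx 0 i) F) z).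
  transitivity (\sum_(k < N) s ^+ k * (k.+1%:R * mpoly.meval (y 0) (taylor_part k.+1 F z))).
    rewrite (horner_coef_wide _ (n := N)); last first.
      apply: (leq_trans (size_poly _ _)).
      by rewrite -subn1 leq_subLR add1n size_poly.
    apply: eq_bigr => k _.
    by rewrite coef_deriv coef_poly ltnS ltn_ord mulr_natl mulrC.
  under [RHS]eq_bigr do rewrite mulr_sumr.
  rewrite exchange_big /=; apply: eq_bigr => k _.
  rewrite mpoly.mevalZ mulVKf// raddf_sum mulr_sumr.
  apply: eq_bigr => i _ /=.
  by rewrite mpoly.mevalM mpoly.mevalXU taylor_part_scale mulrCA.
pose g s := F (z + s *: y) - q.[s].
pose dg s := \sum_i y 0 i * 'D_(delta_mx 0 i) F (z + s *: y) - q^`().[s].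
have -> : F (z + y) - \sum_(k < N.+1) mpoly.meval (y 0) (taylor_part k F z) = g 1 - g 0.
  have q0 : q.[0] = F z by rewrite horner_coef0 coef_poly /= mpoly.mevalC.
  rewrite /g scale1r scale0r addr0 q0 subrr subr0 horner_poly; congr (_ - _).
  by apply: eq_bigr => k _; rewrite expr1n mulr1.
have := @mvt_bound g dg 0 1 ((\sum_i K i) * `|y| ^+ N.+1).
rewrite subr0 normr1 mulr1; apply=> s; rewrite subr0 => s1.
have sy : `|s *: y| < e.
  by rewrite normrZ; apply: le_lt_trans ye; rewrite ler_piMl.
split.
  apply: is_deriveB.
    apply: chain_line oU sF _; apply: HU; rewrite addrAC subrr add0r.
    by apply: lt_le_trans sy _; exact: bigmin_le_id.
rewrite /dg dq -sumrB mulr_suml; apply: le_trans (ler_norm_sum _ _ _) _.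
apply: ler_sum => i _; rewrite -mulrBr normrM exprS mulrCA.
have [K0 r0 Hi] := Hr i.
apply: ler_pM => //; first exact: rv_coord_le.
apply: le_trans (Hi _ _) _; first by apply: lt_le_trans sy _; exact: bigmin_le.
apply: ler_wpM2l => //; apply: lerXn2r; rewrite ?nnegrE// normrZ.
by rewrite ler_piMl.
Qed.

End Taylor.

(** * Extraction of coefficients by finite differences *)

Section FiniteDifference.
Context {R : realType}.

(** The [a]-th finite difference of [u] is the sum of [fd_weight a l * u l]; its
weights are the coefficients of ['X - 1] to the power [a]. *)
Definition fd_weight (a l : nat) : R := (('X - 1) ^+ a : {poly R})`_l.

Lemma fd_weight_gt (a l : nat) : (a < l)%N -> fd_weight a l = 0.
Proof.
move=> al; rewrite /fd_weight nth_default//.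
by rewrite -polyC1 size_exp_XsubC.
Qed.

Lemma fd_weight_norm (a K : nat) : \sum_(l < K) `|fd_weight a l| <= 2 ^+ a.
Proof.
elim: a K => [|a IH] K.
  rewrite expr0; case: K => [|K]; first by rewrite big_ord0.
  rewrite big_ord_recl /fd_weight expr0 coef1 normr1 big1 ?addr0// => i _.
  by rewrite coef1 lift0 normr0.
apply: (@le_trans _ _ (\sum_(l < K)
    (`|(('X - 1) ^+ a * 'X : {poly R})`_l| + `|fd_weight a l|))).
  apply: ler_sum => l _; rewrite /fd_weight exprSr mulrBr mulr1 coefB.
  exact: ler_normB.
rewrite big_split /= exprS mulrDl mul1r; apply: lerD; last exact: IH.
case: K => [|K]; first by rewrite big_ord0 exprn_ge0.
rewrite big_ord_recl coefMX /= normr0 add0r.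
apply: le_trans (IH K); apply: ler_sum => l _.
by rewrite coefMX.
Qed.

(** The operator [p |-> 'X * p^`()] multiplies the coefficient of index [l] by [l];
applied [r] times to [('X - 1) ^+ a] it leaves a factor [('X - 1) ^+ (a - r)],
which vanishes at [1] unless [r = a]. *)
Lemma fd_weight_pow (a r K : nat) : (a < K)%N -> (r <= a)%N ->
  \sum_(l < K) fd_weight a l * l%:R ^+ r = if r == a then a`!%:R else 0.
Proof.
move=> aK ra.
pose th (p : {poly R}) := 'X * p^`().
have thE p l : (th p)`_l = l%:R * p`_l.
  rewrite /th coefXM; case: l => [|l]; first by rewrite mul0r.
  by rewrite /= coef_deriv mulr_natl.
have itE p l : (iter r th p)`_l = l%:R ^+ r * p`_l.
  elim: r {ra} => [|r IH] /=; first by rewrite expr0 mul1r.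
  by rewrite thE IH exprS mulrA.
have key s : (s <= a)%N -> exists2 u : {poly R},
    iter s th (('X - 1) ^+ a) = ('X - 1) ^+ (a - s) * u & u.[1] = (a ^_ s)%:R.
  elim: s => [|s IH] sa.
    by exists 1; rewrite ?subn0 ?mulr1 ?hornerE ?ffactn0.
  have [u Hu u1] := IH (ltnW sa).
  exists ('X * ((a - s)%:R * u + ('X - 1) * u^`())).
    rewrite iterS Hu /th derivM.
    have -> : (a - s = (a - s.+1).+1)%N by rewrite subnSK.
    have d1 : ('X - 1 : {poly R})^`() = 1 by rewrite derivB derivX -polyC1 derivC subr0.
    rewrite deriv_exp d1 mul1r /=.
    rewrite -mulr_natl exprS; ring.
  rewrite !hornerE u1 subrr mul0r addr0 ffactnSr natrM mulrC.
  by rewrite -polyC_natr hornerC.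
have [u Hu u1] := key r ra.
transitivity ((iter r th (('X - 1) ^+ a)).[1]).
  rewrite (horner_coef_wide _ (n := K)); last first.
    apply/leq_sizeP => j Kj; rewrite itE -/(fd_weight a j) fd_weight_gt ?mulr0//.
    exact: leq_trans aK Kj.
  by apply: eq_bigr => l _; rewrite itE expr1n mulr1 mulrC.
rewrite Hu hornerM u1 horner_exp !hornerE subrr.
case: eqP => [->|/eqP ne]; first by rewrite subnn expr0 mul1r ffactnn.
have : (0 < a - r)%N by rewrite subn_gt0 ltn_neqAle ne.
by case: (a - r)%N => // k _; rewrite exprS !mul0r.
Qed.

(** Compare [a.+1 ^ a] with the falling factorial [(a + a) ^_ a] and bound the central
binomial coefficient by [2 ^ (a + a)]. *)
Lemma expn_le_fact (a : nat) : ((a.+1) ^ a <= a`! * 4 ^ a)%N.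
Proof.
have h1 : (a.+1 ^ a <= (a + a) ^_ a)%N.
  have : forall k, (k <= a)%N -> (a.+1 ^ k <= (a + a) ^_ k)%N.
    elim=> // k IH ka; rewrite expnSr ffactnSr leq_mul ?IH ?(ltnW ka)//.
    by lia.
  by apply.
apply: leq_trans h1 _; rewrite -bin_ffact mulnC leq_mul2l; apply/orP; right.
rewrite -[4%N]/(2 ^ 2)%N -expnM mul2n -addnn.
have := expnDn 1 1 (a + a); rewrite addn1 => ->.
have aa : (a < (a + a).+1)%N by rewrite ltnS leq_addr.
rewrite (bigD1 (Ordinal aa)) //= !exp1n !muln1.
exact: leq_addr.
Qed.

Definition cusp_arc n (g : 'I_n -> {poly R}) (m : nat) (v : 'rV[R]_n) (i : 'I_n) :
    {poly R} :=
  g i + v 0 i *: 'X^m.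

(** When [0 < m], [P k] is homogeneous of degree [k] and [g] has no constant term, the
coefficient at [t ^+ j] no longer changes once [N] exceeds [j]. *)
Definition taylor_along n (g : 'I_n -> {poly R}) (m : nat) (P : nat -> mpoly.mpoly n R)
    (N : nat) (v : 'rV[R]_n) : {poly R} :=
  \sum_(k < N) mpoly.mmap polyC (cusp_arc g m v) (P k).

Lemma horner_taylor_along n (g : 'I_n -> {poly R}) m P N v t :
  (taylor_along g m P N v).[t] =
  \sum_(k < N) mpoly.meval ((polycurve (cusp_arc g m v) t) 0) (P k).
Proof.
rewrite /taylor_along horner_sum; apply: eq_bigr => k _.
rewrite mpoly.mevalE /mpoly.mmap horner_sum; apply: eq_bigr => al _.
rewrite hornerM hornerC; congr (_ * _); rewrite /mpoly.mmap1 horner_prod.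
by apply: eq_bigr => i _; rewrite horner_exp mxE.
Qed.

(** Finite difference in [l] of the [j]-th power of an arc depending affinely on [l].
Differences of order [a] annihilate the powers of [l] below the [a]-th, and
every power of [l] comes with a factor ['X^m], which yields the factor
['X^(m * a)].  The cofactor [T] is then evaluated at [0], where [A] vanishes, so
that only the term with [j = a] remains. *)
Lemma fd_pow (a j K m : nat) (A : {poly R}) (b : R) : (a < K)%N -> (0 < m)%N ->
  A`_0 = 0 ->
  exists2 T : {poly R}, \sum_(l < K) fd_weight a l *: (A + (l%:R * b) *: 'X^m) ^+ j =
     b ^+ a *: (T * 'X^(m * a)) & T`_0 = if j == a then a`!%:R else 0.
Proof.
move=> aK m0 A0.
pose S r : R := \sum_(l < K) fd_weight a l * l%:R ^+ r.
pose T : {poly R} := \sum_(r < j.+1 | (a <= r)%N)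
   ('C(j, r)%:R * S r * b ^+ (r - a)) *: (A ^+ (j - r) * 'X^(m * (r - a))).
exists T.
  transitivity (\sum_(r < j.+1)
      ('C(j, r)%:R * S r * b ^+ r) *: (A ^+ (j - r) * 'X^(m * r))).
    under eq_bigr => l _ do rewrite exprDn scaler_sumr.
    rewrite exchange_big /=; apply: eq_bigr => r _.
    rewrite /S mulr_sumr mulr_suml scaler_suml.
    apply: eq_bigr => l _.
    rewrite exprZn -exprM -scalerAr -scaler_nat !scalerA exprMn; congr (_ *: _).
    by ring.
  rewrite (bigID (fun r : 'I_j.+1 => (a <= r)%N)) /= [X in _ + X]big1 ?addr0.
    rewrite /T mulr_suml scaler_sumr; apply: eq_bigr => r ar.
    rewrite -[_ *: _ * 'X^_]scalerAl [RHS]scalerA -[A ^+ _ * _ * _]mulrA -exprD.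
    rewrite -mulnDr subnK//.
    by congr (_ *: _); rewrite [RHS]mulrCA -exprD subnKC.
  move=> r; rewrite -ltnNge => ra.
  by rewrite /S fd_weight_pow ?(ltnW ra)// ltn_eqF// mulr0 mul0r scale0r.
rewrite /T -horner_coef0 horner_sum.
have z i e : (A ^+ i * 'X^e).[0] = ((i == 0%N) && (e == 0%N))%:R.
  rewrite hornerM horner_exp hornerXn horner_coef0 A0 !expr0n.
  by case: eqP; case: eqP; rewrite ?mulr0 ?mul0r ?mulr1.
under eq_bigr => r _ do rewrite hornerZ z.
have [ja|ja] := eqVneq j a.
  rewrite (bigD1 ord_max) ?ja //= subnn muln0 eqxx mulr1 expr0 mulr1 binn mul1r.
  rewrite big1 ?addr0; first by rewrite /S fd_weight_pow// eqxx.
  move=> r /andP[_ rj]; rewrite (_ : (a - r == 0)%N = false) ?mulr0//.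
  apply/negbTE; rewrite subn_eq0 -ltnNge ltn_neqAle -ltnS ltn_ord andbT.
  by apply: contra rj => /eqP E; apply/eqP/val_inj.
rewrite big1// => r ar; case: andP => [[]|_]; rewrite ?mulr0//.
rewrite subn_eq0 muln_eq0 subn_eq0 => jr /orP[/eqP m00|ra].
  by rewrite m00 in m0.
have E1 : (r : nat) = a by apply/eqP; rewrite eqn_leq ra ar.
have E2 : (r : nat) = j by apply/eqP; rewrite eqn_leq jr -ltnS ltn_ord.
by rewrite -E1 E2 eqxx in ja.
Qed.

(** A multivariate finite difference of order [al] in the parameter [v] of the arcs
isolates the coefficient of index [al].  Monomials with an exponent below that
of [al] are annihilated; the others only contribute beyond the power
[m * mdeg al] of [t], since [g] has no constant term. *)
Lemma fd_cusp n (g : 'I_n -> {poly R}) (m : nat) (P : nat -> mpoly.mpoly n R)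
    (al : mnm n) (v0 : 'rV[R]_n) (b : 'I_n -> R) (k := mdeg al) :
  (0 < m)%N -> (forall i, (g i)`_0 = 0) ->
  (forall l be, mdeg be != l -> mpoly.mcoeff be (P l) = 0) ->
  \sum_(f : {ffun 'I_n -> 'I_k.+1}) (\prod_i fd_weight (al i) (f i)) *
     (taylor_along g m P (m * k).+1 (\row_i (v0 0 i + (f i)%:R * b i)))`_(m * k) =
  \prod_i ((al i)`!%:R * b i ^+ al i) * mpoly.mcoeff al (P k).
Proof.
move=> m0 g0 hP.
have alk i : (al i < k.+1)%N by rewrite ltnS /k mpoly.mdegE (bigD1 i) //= leq_addr.
pose v f : 'rV[R]_n := \row_i (v0 0 i + (f i : 'I_k.+1)%:R * b i).
pose A i := g i + v0 0 i *: 'X^m.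
have A0 i : (A i)`_0 = 0.
  by rewrite coefD g0 add0r coefZ coefXn (ltn_eqF m0) mulr0.
have YE f i : cusp_arc g m (v f) i = A i + ((f i)%:R * b i) *: 'X^m.
  by rewrite /cusp_arc mxE scalerDl addrA.
have mono (be : mnm n) : (\sum_(f : {ffun 'I_n -> 'I_k.+1})
    (\prod_i fd_weight (al i) (f i)) *: mpoly.mmap1 (cusp_arc g m (v f)) be)`_(m * k) =
    (be == al)%:R * \prod_i ((al i)`!%:R * b i ^+ al i).
  have /choice[T HT] (i : 'I_n) : exists T : {poly R},
      \sum_(l < k.+1) fd_weight (al i) l *: (A i + (l%:R * b i) *: 'X^m) ^+ be i =
        b i ^+ al i *: (T * 'X^(m * al i)) /\
      T`_0 = if be i == al i then (al i)`!%:R else 0.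
    by have [T ? ?] := fd_pow (be i) (b i) (alk i) m0 (A0 i); exists T.
  have -> : \sum_(f : {ffun 'I_n -> 'I_k.+1})
      (\prod_i fd_weight (al i) (f i)) *: mpoly.mmap1 (cusp_arc g m (v f)) be =
      (\prod_i b i ^+ al i) *: ((\prod_i T i) * 'X^(m * k)).
    transitivity (\sum_(f : {ffun 'I_n -> 'I_k.+1})
       \prod_i (fd_weight (al i) (f i) *: (A i + ((f i)%:R * b i) *: 'X^m) ^+ be i)).
      apply: eq_bigr => f _; rewrite scaler_prod; congr (_ *: _).
      by apply: eq_bigr => i _; rewrite YE.
    rewrite -(bigA_distr_bigA (fun i (l : 'I_k.+1) =>
       fd_weight (al i) l *: (A i + (l%:R * b i) *: 'X^m) ^+ be i)).
    rewrite (eq_bigr (fun i => b i ^+ al i *: (T i * 'X^(m * al i)))); last first.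
      by move=> i _; have [] := HT i.
    rewrite scaler_prod big_split /=; congr (_ *: (_ * _)).
    by rewrite prodrXr -big_distrr /= -mpoly.mdegE.
  rewrite coefZ coefMXn ltnn subnn -horner_coef0 horner_prod.
  case: eqP => [E|/eqP ne]; last first.
    have [i bi] : exists i, be i != al i.
      apply/existsP; rewrite -negb_forall; apply: contra ne => /forallP H.
      by apply/eqP/mpoly.mnmP => i; apply/eqP.
    rewrite mul0r [X in _ * X](bigD1 i) //= horner_coef0; have [_ ->] := HT i.
    by rewrite (negbTE bi) mul0r mulr0.
  rewrite mul1r -big_split; apply: eq_bigr => i _ /=.
  by rewrite horner_coef0; have [_ ->] := HT i; rewrite E eqxx mulrC.
transitivity ((\sum_(f : {ffun 'I_n -> 'I_k.+1})
    (\prod_i fd_weight (al i) (f i)) *: taylor_along g m P (m * k).+1 (v f))`_(m * k)).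
  by rewrite coef_sum; apply: eq_bigr => f _; rewrite coefZ.
transitivity (\sum_(l < (m * k).+1) \sum_(be <- mpoly.msupp (P l))
   mpoly.mcoeff be (P l) * ((be == al)%:R * \prod_i ((al i)`!%:R * b i ^+ al i))).
  rewrite (_ : \sum_(f : {ffun 'I_n -> 'I_k.+1}) _ =
      \sum_(l < (m * k).+1) \sum_(be <- mpoly.msupp (P l)) mpoly.mcoeff be (P l) *:
       \sum_(f : {ffun 'I_n -> 'I_k.+1})
         (\prod_i fd_weight (al i) (f i)) *: mpoly.mmap1 (cusp_arc g m (v f)) be).
    rewrite coef_sum; apply: eq_bigr => l _; rewrite coef_sum.
    by apply: eq_bigr => be _; rewrite coefZ mono.
  transitivity (\sum_(f : {ffun 'I_n -> 'I_k.+1}) \sum_(l < (m * k).+1)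
      \sum_(be <- mpoly.msupp (P l)) mpoly.mcoeff be (P l) *:
         ((\prod_i fd_weight (al i) (f i)) *: mpoly.mmap1 (cusp_arc g m (v f)) be)).
    apply: eq_bigr => f _; rewrite /taylor_along scaler_sumr; apply: eq_bigr => l _.
    rewrite /mpoly.mmap scaler_sumr; apply: eq_bigr => be _.
    by rewrite mul_polyC !scalerA mulrC.
  rewrite exchange_big /=; apply: eq_bigr => l _.
  by rewrite exchange_big /=; apply: eq_bigr => be _; rewrite scaler_sumr.
have kl : (k < (m * k).+1)%N by rewrite ltnS leq_pmull.
rewrite (bigD1 (Ordinal kl)) //= [X in _ + X]big1 ?addr0; last first.
  move=> l lk; rewrite big1_seq// => be /andP[_ bl].
  case: eqP => [E|]; rewrite ?mul0r ?mulr0//.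
  by rewrite hP ?mul0r// E eq_sym; apply: contra lk => /eqP E2; apply/eqP/val_inj.
have [sup|sup] := boolP (al \in mpoly.msupp (P k)).
  rewrite (bigD1_seq al) ?mpoly.msupp_uniq//= eqxx mul1r [X in _ + X]big1 ?addr0 1?mulrC//.
  by move=> be /negbTE ->; rewrite mul0r mulr0.
rewrite (mpoly.memN_msupp_eq0 sup) mulr0 big1_seq// => be /andP[_ bs].
case: eqP => [E|]; rewrite ?mul0r ?mulr0//.
by rewrite -E bs in sup.
Qed.

End FiniteDifference.

(** * Uniform bounds by Baire's theorem *)

(** Baire's theorem is about complete normed modules. *)
HB.instance Definition _ (R : realType) (m n : nat) := Complete.on (matrix R m n).

Section Baire.
Context {R : realType}.

Lemma continuous_sum (V : topologicalType) (I : Type) (r : seq I) (f : I -> V -> R) :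
  (forall i, continuous (f i)) -> continuous (fun v => \sum_(i <- r) f i v).
Proof.
move=> H; elim: r => [|i r IH] v.
  by under eq_fun do rewrite big_nil; exact: cvg_cst.
under eq_fun do rewrite big_cons.
by apply: cvgD; [exact: H|exact: IH].
Qed.

Definition coefs_continuous (V : topologicalType) (f : V -> {poly R}) : Prop :=
  forall j, continuous (fun v => (f v)`_j).

Lemma coefs_continuous_cst (V : topologicalType) p : coefs_continuous (fun _ : V => p).
Proof. by move=> j v; exact: cvg_cst. Qed.

Lemma coefs_continuousM (V : topologicalType) (f g : V -> {poly R}) :
  coefs_continuous f -> coefs_continuous g -> coefs_continuous (fun v => f v * g v).
Proof.
move=> cf cg j; under eq_fun do rewrite coefM.
apply: continuous_sum => i v; apply: cvgM; [exact: cf|exact: cg].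
Qed.

Lemma coefs_continuousD (V : topologicalType) (f g : V -> {poly R}) :
  coefs_continuous f -> coefs_continuous g -> coefs_continuous (fun v => f v + g v).
Proof.
move=> cf cg j; under eq_fun do rewrite coefD.
by move=> v; apply: cvgD; [exact: cf|exact: cg].
Qed.

Lemma coefs_continuousZ (V : topologicalType) (f : V -> R) (p : {poly R}) :
  continuous f -> coefs_continuous (fun v => f v *: p).
Proof.
move=> cf j; under eq_fun do rewrite coefZ.
by move=> v; apply: cvgMr_tmp; exact: cf.
Qed.

Lemma coefs_continuousX (V : topologicalType) (f : V -> {poly R}) k :
  coefs_continuous f -> coefs_continuous (fun v => f v ^+ k).
Proof.
move=> cf; elim: k => [|k IH].
  by under eq_fun do rewrite expr0; exact: coefs_continuous_cst.
by under eq_fun do rewrite exprS; exact: coefs_continuousM.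
Qed.

Lemma coefs_continuous_sum (V : topologicalType) (I : Type) (r : seq I)
    (f : I -> V -> {poly R}) :
  (forall i, coefs_continuous (f i)) -> coefs_continuous (fun v => \sum_(i <- r) f i v).
Proof.
move=> H j; under eq_fun do rewrite coef_sum.
by apply: continuous_sum => i; exact: H.
Qed.

Lemma coefs_continuous_prod (V : topologicalType) (I : Type) (r : seq I)
    (f : I -> V -> {poly R}) :
  (forall i, coefs_continuous (f i)) -> coefs_continuous (fun v => \prod_(i <- r) f i v).
Proof.
move=> H; elim: r => [|i r IH].
  by under eq_fun do rewrite big_nil; exact: coefs_continuous_cst.
by under eq_fun do rewrite big_cons; exact: coefs_continuousM.
Qed.

Lemma taylor_along_continuous n (g : 'I_n -> {poly R}) m (P : nat -> mpoly.mpoly n R) N :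
  coefs_continuous (fun v : 'rV[R]_n => taylor_along g m P N v).
Proof.
apply: coefs_continuous_sum => k; apply: coefs_continuous_sum => al.
apply: coefs_continuousM; first exact: coefs_continuous_cst.
apply: coefs_continuous_prod => i; apply: coefs_continuousX.
apply: coefs_continuousD; first exact: coefs_continuous_cst.
by apply: coefs_continuousZ; exact: (@coord_continuous R 1 n 0 i).
Qed.

Lemma open_norm_gt (V : topologicalType) (f : V -> R) (c : R) :
  continuous f -> open [set v | c < `|f v|].
Proof.
move=> cf; rewrite openE => v /= Hv.
have /cvgrPdist_lt : (fun v => `|f v|) @ v --> `|f v|.
  by apply: cvg_norm; exact: cf.
move=> /(_ (`|f v| - c)); rewrite subr_gt0 => /(_ Hv).
apply: filterS => w Hw /=.
by have := ler_norm (`|f v| - `|f w|); lra.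
Qed.

(** If no [B] worked on any ball, the open sets where [B] fails for some [k] would be
dense, and a common point of them in the ball of radius [M] would contradict the
hypothesis.  The ball obtained need not lie in the one of radius [M]. *)
Lemma baire_bound n (q : nat -> 'rV[R]_n -> R) (M : R) : 0 < M ->
  (forall k, continuous (q k)) ->
  (forall v, `|v| < M -> exists B : nat, forall k, `|q k v| <= B%:R ^+ k.+1) ->
  exists v0 r (B : nat), 0 < r /\
    forall v, `|v - v0| < r -> forall k, `|q k v| <= B%:R ^+ k.+1.
Proof.
move=> M0 cq Hq; apply: contrapT => Hno.
pose O (B : nat) := [set v : 'rV[R]_n | exists k, B%:R ^+ k.+1 < `|q k v|].
have OP B : open (O B) /\ dense (O B).
  split.
    rewrite (_ : O B = \bigcup_k [set v | B%:R ^+ k.+1 < `|q k v|]).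
      by apply: bigcup_open => k _; exact: open_norm_gt.
    by apply/seteqP; split=> v [k]; [exists k|exists k].
  move=> D [v0 Dv0] oD; apply: contrapT => HD.
  have [r r0 Hr] := near_ball_elim (open_nbhs_nbhs (conj oD Dv0)).
  apply: Hno; exists v0, r, B; split => // v vr k.
  rewrite leNgt; apply/negP => Hk; apply: HD; exists v; split; first exact: Hr.
  by exists k.
have := @Baire R 'rV[R]_n O OP (ball 0 M).
have b0 : ball (0 : 'rV[R]_n) M 0 by exact: ballxx.
move=> /(_ (ex_intro _ 0 b0) (ball_open _ _)) [v [bv Ov]].
have [|B HB] := Hq v; first by move: bv; rewrite -ball_normE /= sub0r normrN.
have [k] := Ov B I.
by rewrite ltNge HB.
Qed.

(** Use [fd_cusp] on a grid in the ball of steps [r / (al i).+1]: the weights have total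
mass at most [2 ^+ mdeg al], and [expn_le_fact] compensates the steps by the
factorials. *)
Lemma taylor_coef_bound n (g : 'I_n -> {poly R}) (m : nat) (P : nat -> mpoly.mpoly n R)
    (v0 : 'rV[R]_n) (r B : R) :
  (0 < m)%N -> (forall i, (g i)`_0 = 0) ->
  (forall l be, mdeg be != l -> mpoly.mcoeff be (P l) = 0) ->
  0 < r -> 0 < B ->
  (forall v, `|v - v0| < r -> forall k,
     `|(taylor_along g m P (m * k).+1 v)`_(m * k)| <= B ^+ k.+1) ->
  geom_bounded (fun al => mpoly.mcoeff al (P (mdeg al))) B (8 * B / r).
Proof.
move=> m0 g0 hP r0 B0 H; split; first exact: ltW.
  by rewrite divr_gt0// mulr_gt0.
move=> al; set k := mdeg al.
pose b (i : 'I_n) : R := r / (al i).+1%:R.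
have := fd_cusp al v0 b m0 g0 hP; rewrite -/k => E.
have e1 : `|\prod_i ((al i)`!%:R * b i ^+ al i) * mpoly.mcoeff al (P k)|
    <= 2 ^+ k * B ^+ k.+1.
  rewrite -E; apply: le_trans (ler_norm_sum _ _ _) _.
  apply: (@le_trans _ _ (\sum_(f : {ffun 'I_n -> 'I_k.+1})
      (\prod_i `|fd_weight (al i) (f i)|) * B ^+ k.+1)).
    apply: ler_sum => f _; rewrite normrM normr_prod.
    (* Grid points outside the ball have weight zero. *)
    have [/existsP[i Hi]|/existsPn Hf] := boolP [exists i, (al i < f i)%N].
      by rewrite (bigD1 i) //= (fd_weight_gt Hi) normr0 !mul0r.
    apply: ler_wpM2l; first by apply: prodr_ge0.
    apply: H; apply: rv_norm_lt => // i; rewrite !mxE addrAC subrr add0r.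
    have := Hf i; rewrite -leqNgt => fi.
    rewrite ger0_norm; last by rewrite mulr_ge0// divr_ge0// ltW.
    rewrite /b mulrCA -[ltRHS]mulr1 ltr_pM2l// ltr_pdivrMr// mul1r ltr_nat.
    by rewrite ltnS.
  rewrite -mulr_suml; apply: ler_wpM2r; first by apply: exprn_ge0; exact: ltW.
  rewrite -(bigA_distr_bigA (fun i (l : 'I_k.+1) => `|fd_weight (al i) l|)).
  rewrite /k mpoly.mdegE -prodrXr; apply: ler_prod => i _.
  by rewrite fd_weight_norm andbT; apply: sumr_ge0.
have e2 : (r / 4) ^+ k <= `|\prod_i ((al i)`!%:R * b i ^+ al i)|.
  rewrite normr_prod /k mpoly.mdegE -prodrXr; apply: ler_prod => i _.
  rewrite exprn_ge0/=; last by rewrite divr_ge0// ltW.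
  rewrite ger0_norm; last first.
    by rewrite mulr_ge0// exprn_ge0// divr_ge0// ltW.
  rewrite /b !exprMn mulrCA ler_wpM2l//; first by rewrite exprn_ge0// ltW.
  rewrite !exprVn ler_pdivlMr ?exprn_gt0// ler_pdivrMl ?exprn_gt0//.
  by rewrite -!natrX -natrM ler_nat mulnC expn_le_fact.
rewrite normrM in e1.
have e3 := le_trans (ler_wpM2r (normr_ge0 _) e2) e1.
have r4 : 0 < (r / 4) ^+ k by rewrite exprn_gt0// divr_gt0.
move: e3; rewrite -ler_pdivlMl// => /le_trans; apply.
rewrite le_eqVlt; apply/orP; left; apply/eqP.
rewrite -exprVn exprS (_ : 8 * B / r = (r / 4)^-1 * 2 * B); last by field; lra.
by rewrite !exprMn; ring.
Qed.

End Baire.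

(** * Cusps and convergence of the Taylor series *)

Section Geometry.
Context {R : realType}.

Lemma near_interior n (X : set 'rV[R]_n) (x : 'rV[R]_n) (e : R) : 0 < e ->
  (forall y, `|y - x| < e -> X y) -> interior X x.
Proof. by move=> e0 H; apply: (near_ball_intro e0). Qed.

(** A cusp with tip [z]: the images of the arcs [polycurve H t + t ^+ m *: v] for small
[v] form, at each parameter [t != 0], a ball inside [X]. *)
Definition cusp_at n (X : set 'rV[R]_n) (z : 'rV[R]_n)
    (H : 'I_n -> {poly R}) (m : nat) (M : R) : Prop :=
  [/\ (0 < m)%N, 0 < M, polycurve H 0 = z, X z &
    forall (t : R) (v : 'rV[R]_n), 0 < `|t| -> `|t| <= 1 -> `|v| < M ->
      interior X (polycurve H t + t ^+ m *: v)].

Lemma cusp_interior n (X : set 'rV[R]_n) z : interior X z ->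
  exists H m M, cusp_at X z H m M.
Proof.
move=> Xz; have [e e0 He] := near_ball_elim (nbhs_interior Xz).
exists (fun i => (z 0 i)%:P), 1%N, e.
have zE t : polycurve (fun i => (z 0 i)%:P) t = z.
  by apply/rowP => i; rewrite mxE hornerC.
split=> //; first exact: interior_subset Xz.
move=> t v _ t1 ve; rewrite zE expr1; apply: He.
rewrite addrAC subrr add0r normrZ; apply: le_lt_trans ve.
by rewrite ler_piMl.
Qed.

Lemma eucl_dist_le n (x y : 'rV[R]_n) : eucl_dist x y <= n.+1%:R * `|x - y|.
Proof.
rewrite /eucl_dist -[leRHS]ger0_norm; last by rewrite mulr_ge0.
rewrite -sqrtr_sqr; apply: ler_wsqrtr.
apply: (@le_trans _ _ (\sum_(i < n) `|x - y| ^+ 2)).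
  apply: ler_sum => i _; rewrite -[leLHS]ger0_norm ?sqr_ge0// normrX.
  by apply: lerXn2r; rewrite ?nnegrE//; have := rv_coord_le (x - y) i; rewrite !mxE.
rewrite sumr_const card_ord exprMn -[_ *+ n]mulr_natl; apply: ler_wpM2r.
  exact: sqr_ge0.
by rewrite -natrX ler_nat; lia.
Qed.

(** Replacing [t] by [t ^+ 2] keeps the arcs in [X] for negative parameters.  The factor
[n.+1] compares the Euclidean norm with the norm of the maximum. *)
Lemma cusp_UPC n (X Y : set 'rV[R]_n) z : UPC Y -> Y z -> Y `<=` X ->
  exists H m M, cusp_at X z H m M.
Proof.
move=> [_ [m [D [M [m0 _ M0 HY]]]]] Yz YX.
have [h [_ h0 Hh]] := HY z Yz.
have n0 : 0 < (n.+1%:R : R) by [].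
exists (fun i => h i \Po 'X^2), (2 * m)%N, (M / n.+1%:R).
have hE t : polycurve (fun i => h i \Po 'X^2) t = polycurve h (t ^+ 2).
  by apply/rowP => i; rewrite !mxE horner_comp hornerXn.
split; rewrite ?muln_gt0 ?divr_gt0//.
- by rewrite hE expr0n.
- exact: YX.
move=> t v t0 t1 vM; rewrite hE exprM; set s := t ^+ 2.
have s0 : 0 < s by rewrite /s -[_ ^+ 2]ger0_norm ?sqr_ge0// normrX exprn_gt0.
have s1 : s <= 1 by rewrite /s -[_ ^+ 2]ger0_norm ?sqr_ge0// normrX exprn_ile1.
have sm0 : 0 < s ^+ m by rewrite exprn_gt0.
apply: (@near_interior _ _ _ (s ^+ m * (M / n.+1%:R - `|v|))).
  by rewrite mulr_gt0// subr_gt0.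
move=> y Hy; apply: YX; apply: contrapT => nY.
have /Hh : 0 <= s <= 1 by rewrite (ltW s0).
have : (dist_set (polycurve h s) (~` Y) <= (eucl_dist (polycurve h s) y)%:E)%E.
  by apply: ereal_inf_lbound; exists y.
move=> /[swap] /le_trans /[apply]; rewrite lee_fin => le1.
have le2 := le_trans le1 (eucl_dist_le _ _).
have : `|polycurve h s - y| < s ^+ m * (M / n.+1%:R).
  have -> : polycurve h s - y = - (y - (polycurve h s + s ^+ m *: v)) - s ^+ m *: v.
    by apply/rowP => i; rewrite !mxE; ring.
  apply: le_lt_trans (ler_normB _ _) _; rewrite normrN normrZ (ger0_norm (ltW sm0)).
  by move: Hy; rewrite mulrBr ltrBrDr.
rewrite -(ltr_pM2l n0) => /(le_lt_trans le2).
rewrite (_ : n.+1%:R * (s ^+ m * (M / n.+1%:R)) = M * s ^+ m) ?ltxx//.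
by field; rewrite gt_eqF.
Qed.

Lemma horner_noconst (p : {poly R}) (t : R) : p`_0 = 0 -> `|t| <= 1 ->
  `|p.[t]| <= (\sum_(i < size p) `|p`_i|) * `|t|.
Proof.
move=> p0 t1; rewrite horner_coef; apply: le_trans (ler_norm_sum _ _ _) _.
rewrite mulr_suml; apply: ler_sum => -[[|i] Hi] _ /=.
  by rewrite p0 mul0r normr0 mul0r.
rewrite normrM normrX ler_wpM2l// exprS -[leRHS]mulr1 ler_wpM2l//.
exact: exprn_ile1.
Qed.

Definition arc_offset n (H : 'I_n -> {poly R}) (z : 'rV[R]_n) (i : 'I_n) : {poly R} :=
  H i - (z 0 i)%:P.

Lemma arc_offset0 n (H : 'I_n -> {poly R}) z i :
  polycurve H 0 = z -> (arc_offset H z i)`_0 = 0.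
Proof.
by move=> <-; rewrite coefB coefC /= mxE horner_coef0 subrr.
Qed.

Lemma polycurve_offset_arc n (H : 'I_n -> {poly R}) z m (v : 'rV[R]_n) t :
  polycurve (cusp_arc (arc_offset H z) m v) t = polycurve H t + t ^+ m *: v - z.
Proof.
by apply/rowP => i; rewrite !mxE /cusp_arc /arc_offset !hornerE; ring.
Qed.

Lemma polycurve_cusp_arc n (H : 'I_n -> {poly R}) m (v : 'rV[R]_n) t :
  polycurve (cusp_arc H m v) t = polycurve H t + t ^+ m *: v.
Proof. by apply/rowP => i; rewrite !mxE /cusp_arc !hornerE; ring. Qed.

Lemma cusp_arc_le n (H : 'I_n -> {poly R}) z m (M : R) : (0 < m)%N ->
  polycurve H 0 = z -> 0 < M ->
  exists2 L : R, 0 < L & forall (v : 'rV[R]_n) t, `|v| < M -> `|t| <= 1 ->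
    `|polycurve H t + t ^+ m *: v - z| <= L * `|t|.
Proof.
move=> m0 H0 M0.
pose S i := \sum_(j < size (arc_offset H z i)) `|(arc_offset H z i)`_j|.
have S0 i : 0 <= S i by apply: sumr_ge0.
exists (\sum_i S i + M); first by apply: ltr_wpDl => //; apply: sumr_ge0.
move=> v t vM t1; rewrite -polycurve_offset_arc; apply: rv_norm_le => [|i].
  by rewrite mulr_ge0// addr_ge0 ?(ltW M0)//; apply: sumr_ge0.
rewrite mxE /cusp_arc hornerD hornerZ hornerXn mulrDl.
apply: le_trans (ler_normD _ _) _; apply: lerD.
  apply: (le_trans (horner_noconst (arc_offset0 i H0) t1)).
  apply: ler_wpM2r => //; rewrite (bigD1 i) //= lerDl.
  exact: sumr_ge0.
rewrite normrM; apply: ler_pM => //.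
  by apply: le_trans (rv_coord_le _ _) (ltW vM).
rewrite normrX; case: m m0 => // m _.
rewrite exprS -[leRHS]mulr1 ler_wpM2l//; exact: exprn_ile1.
Qed.

Definition taylor_coef n (F : 'rV[R]_n -> R) (z : 'rV[R]_n) (al : mnm n) : R :=
  mpoly.mcoeff al (taylor_part (mdeg al) F z).

Lemma partial_powsum_taylor n (F : 'rV[R]_n -> R) z N (y : 'rV[R]_n) :
  partial_powsum (taylor_coef F z) N y = \sum_(k < N) mpoly.meval (y 0) (taylor_part k F z).
Proof.
apply: (sums_uniq (@sums_partial_powsum _ n (taylor_coef F z) N y)).
have fin : forall r : seq 'I_N, sums (fun al : mnm n =>
     \sum_(k <- r) mpoly.mcoeff al (taylor_part k F z) * monomial y al)
   (\sum_(k <- r) mpoly.meval (y 0) (taylor_part k F z)).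
  elim=> [|k r IH].
    rewrite big_nil; have := @sums_finite R (mnm n) (fun=> 0) [::] isT.
    rewrite big_nil => /(_ (fun _ _ => erefl)); congr sums.
    by apply/funext => al; rewrite big_nil.
  rewrite big_cons; have := sumsD (@sums_meval _ _ (taylor_part k F z) y) IH.
  by congr sums; apply/funext => al; rewrite big_cons.
have := fin (index_enum 'I_N); congr sums; apply/funext => al.
rewrite -mulr_suml; case: ltnP => [lt|ge].
  congr (_ * _); rewrite (bigD1 (Ordinal lt)) //= big1 ?addr0// => k kl.
  rewrite taylor_part_homog//; apply: contra kl => /eqP E; apply/eqP/val_inj => /=.
  by rewrite E.
rewrite big1 ?mul0r// => k _; rewrite taylor_part_homog//.
by rewrite gtn_eqF// (leq_trans (ltn_ord k)).
Qed.

Section Local.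
Context (n : nat) (X U : set 'rV[R]_n) (F : 'rV[R]_n -> R).
Context (oU : open U) (XU : X `<=` U) (sF : smooth_on U F) (aF : arc_analytic X F).

Lemma cusp_arc_in z H m M (v : 'rV[R]_n) t : cusp_at X z H m M -> `|v| < M ->
  `|t| <= 1 -> X (polycurve (cusp_arc H m v) t).
Proof.
move=> [m0 M0 H0 Xz HX] vM t1; rewrite polycurve_cusp_arc.
have [->|t0] := eqVneq t 0.
  by rewrite H0 expr0n gtn_eqF// scale0r addr0.
by apply: interior_subset; apply: HX => //; rewrite normr_gt0.
Qed.

Lemma cusp_arc_expandable z H m M (v : 'rV[R]_n) t : cusp_at X z H m M -> `|v| < M ->
  `|t| < 1 -> expandable (fun t => F (polycurve (cusp_arc H m v) t)) t.
Proof.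
move=> cz vM t1; apply: aF; exists (1 - `|t|); first by rewrite subr_gt0.
move=> s st; apply: cusp_arc_in cz vM _.
rewrite -[s](subrK t); apply: le_trans (ler_normD _ _) _; lra.
Qed.

Lemma taylor_remainder_arc z H m M N : cusp_at X z H m M ->
  exists K e, [/\ 0 <= K, 0 < e & forall (v : 'rV[R]_n) t, `|v| < M -> `|t| < e ->
   `|F (polycurve (cusp_arc H m v) t) -
     \sum_(k < N) mpoly.meval ((polycurve (cusp_arc (arc_offset H z) m v) t) 0)
       (taylor_part k F z)|
    <= K * `|t| ^+ N].
Proof.
move=> [m0 M0 H0 Xz _].
have [K [e [K0 e0 HT]]] := taylor_smooth N oU (XU Xz) sF.
have [L L0 HL] := cusp_arc_le m0 H0 M0.
exists (K * L ^+ N), (Num.min 1 (e / L)); split.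
- by rewrite mulr_ge0// exprn_ge0// ltW.
- by rewrite lt_min ltr01 divr_gt0.
move=> v t vM; rewrite lt_min => /andP[t1 te].
have yL := HL v t vM (ltW t1).
have := HT (polycurve (cusp_arc (arc_offset H z) m v) t).
rewrite polycurve_offset_arc polycurve_cusp_arc.
rewrite [z + _]addrC subrK => h; apply: le_trans (h _) _.
  by apply: le_lt_trans yL _; rewrite mulrC -ltr_pdivlMr.
rewrite -mulrA; apply: ler_wpM2l => //; rewrite -exprMn.
by apply: lerXn2r; rewrite ?nnegrE// mulr_ge0// ltW.
Qed.

(** Along each arc of the cusp the Taylor polynomials of [F] give the coefficients of
the analytic function [F] along the arc, whence the pointwise geometric bounds
required by [baire_bound]; [taylor_coef_bound] then controls the coefficients
themselves. *)
Lemma taylor_geom_bounded z H m M : cusp_at X z H m M ->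
  exists K C, geom_bounded (taylor_coef F z) K C.
Proof.
move=> cz; have [m0 M0 H0 Xz _] := cz.
pose P k := taylor_part k F z.
pose g := arc_offset H z.
pose q k (v : 'rV[R]_n) := (taylor_along g m P (m * k).+1 v)`_(m * k).
have [k|v vM|v0 [r [B [r0 HB]]]] := @baire_bound R n q M M0.
- exact: taylor_along_continuous.
- have [|a [C HC]] := @cusp_arc_expandable z H m M v 0 cz vM; first by rewrite normr0.
  have C0 : 0 < C by case: HC.
  (* [2 * C] bounds the constant of the expansion and [C ^+ m] its growth per step. *)
  exists (Num.truncn (2 * C + C ^+ m)).+1 => k.
  set B := _%:R; have hB : 2 * C + C ^+ m < B by exact: truncnS_gt.
  have [K [e [K0 e0 HT]]] := taylor_remainder_arc (m * k).+1 cz.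
  have -> : q k v = a (m * k)%N.
    rewrite (expansion_coef_poly HC e0 (q := taylor_along g m P (m * k).+1 v)
      (N := (m * k).+1) (K := K) _ (ltnSn _)) //.
    by move=> t te; rewrite add0r horner_taylor_along; exact: HT.
  apply: le_trans (expansion_coef_le HC _) _; rewrite exprS exprM.
  have Cm : 0 < C ^+ m by rewrite exprn_gt0.
  apply: ler_pM; rewrite ?exprn_ge0 ?mulr_ge0 ?(ltW C0) ?(ltW Cm)//; first lra.
  by apply: lerXn2r; rewrite ?nnegrE; lra.
exists B.+1%:R, (8 * B.+1%:R / r).
apply: (@taylor_coef_bound R n g m P v0 r B.+1%:R) => //.
- by move=> i; exact: arc_offset0.
- by move=> l be; exact: taylor_part_homog.
move=> v vr k; apply: le_trans (HB v vr k) _.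
by apply: lerXn2r; rewrite ?nnegrE// ler_nat.
Qed.

(** The interval [[0, d]] is common to all [v] because it only has to keep the arcs
in the disc of convergence; the interval on which the two expansions at [0] can
be compared depends on [v], and [expandable_identity] bridges the gap. *)
Lemma cusp_agree z H m M K C : cusp_at X z H m M -> geom_bounded (taylor_coef F z) K C ->
  exists2 d, 0 < d & forall t (v : 'rV[R]_n), 0 <= t <= d -> `|v| < M ->
    F (polycurve H t + t ^+ m *: v) =
    powsum (taylor_coef F z) (polycurve H t + t ^+ m *: v - z).
Proof.
move=> cz gT; have [m0 M0 H0 Xz _] := cz; have [K0 C0 _] := gT.
have [L L0 HL] := cusp_arc_le m0 H0 M0.
pose d := Num.min 2^-1 (2 * C * L)^-1.
have d0 : 0 < d by rewrite lt_min !invr_gt0 ltr0n /= !mulr_gt0.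
have dC (v : 'rV[R]_n) t : `|v| < M -> `|t| <= d ->
    2 * C * `|polycurve H t + t ^+ m *: v - z| <= 1.
  move=> vM; rewrite le_min => /andP[td1 td2].
  have t1 : `|t| <= 1 by lra.
  apply: (@le_trans _ _ (2 * C * (L * `|t|))).
    by apply: ler_wpM2l (HL _ _ vM t1); rewrite mulr_ge0// ltW.
  by rewrite mulrA mulrC -ler_pdivlMr ?mulr_gt0// mul1r.
exists d => // t v td vM.
pose G (x : 'rV[R]_n) := powsum (taylor_coef F z) (x - z).
pose D t := F (polycurve (cusp_arc H m v) t) - G (polycurve (cusp_arc H m v) t).
suff : D t = 0 by move=> /eqP; rewrite subr_eq0 => /eqP; rewrite /G polycurve_cusp_arc.
apply: (@expandable_identity R D d) => //.
  move=> s /andP[s0 sd]; apply: expandableB.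
    apply: cusp_arc_expandable cz vM _; rewrite ger0_norm//.
    have d2 : d <= 2^-1 by rewrite ge_min lexx.
    by lra.
  apply: analytic_curve; apply: (powsum_analytic_at gT); rewrite polycurve_cusp_arc.
  have := dC v s vM; rewrite ger0_norm// => /(_ sd).
  have : 0 <= C * `|polycurve H s + s ^+ m *: v - z| by rewrite mulr_ge0// ltW.
  lra.
have [||e e0 He] := @expandable_flat R D 0; last by exists e => // s /He; rewrite add0r.
  apply: expandableB; first by apply: cusp_arc_expandable cz vM _; rewrite normr0.
  apply: analytic_curve; apply: (powsum_analytic_at gT); rewrite polycurve_cusp_arc.
  have := dC v 0 vM; rewrite normr0 (ltW d0) => /(_ isT).
  have : 0 <= C * `|polycurve H 0 + 0 ^+ m *: v - z| by rewrite mulr_ge0// ltW.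
  lra.
move=> N; have [KT [e [KT0 e0 HT]]] := taylor_remainder_arc N cz.
pose K' := K * 2 ^+ n * (2 * C * L) ^+ N.
exists (KT + K'), (Num.min e d); split; first by rewrite lt_min e0.
move=> s; rewrite lt_min => /andP[se sd]; rewrite add0r.
have h1 := HT v s vM se.
have h2 := powsum_remainder N gT (dC v s vM (ltW sd)).
rewrite partial_powsum_taylor -polycurve_offset_arc in h2.
have -> : D s = (F (polycurve (cusp_arc H m v) s) -
     \sum_(k < N) mpoly.meval ((polycurve (cusp_arc (arc_offset H z) m v) s) 0)
       (taylor_part k F z)) -
    (powsum (taylor_coef F z) (polycurve (cusp_arc (arc_offset H z) m v) s) -
     \sum_(k < N) mpoly.meval ((polycurve (cusp_arc (arc_offset H z) m v) s) 0)
       (taylor_part k F z)).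
  by rewrite /D /G polycurve_offset_arc polycurve_cusp_arc; ring.
apply: le_trans (ler_normB _ _) _; rewrite mulrDl; apply: lerD => //.
apply: le_trans h2 _; rewrite /K' -[_ * _ * `|s| ^+ N]mulrA -exprMn; apply: ler_wpM2l.
  by rewrite mulr_ge0// exprn_ge0.
have CL : 0 < 2 * C by rewrite mulr_gt0.
apply: lerXn2r; rewrite ?nnegrE; first by rewrite mulr_ge0// ltW.
  by rewrite !mulr_ge0// ltW.
rewrite -[2 * C * L * _]mulrA ler_pM2l// polycurve_offset_arc; apply: HL => //.
by move: sd; rewrite lt_min => /andP[]; lra.
Qed.

End Local.

End Geometry.

(** * Local analytic extensions and their gluing *)

Section Extension.
Context {R : realType}.

Definition line (n : nat) (y0 y : 'rV[R]_n) (i : 'I_n) : {poly R} :=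
  (y0 0 i)%:P + (y 0 i - y0 0 i) *: 'X.

Lemma lineE n (y0 y : 'rV[R]_n) t : polycurve (line y0 y) t = y0 + t *: (y - y0).
Proof. by apply/rowP => i; rewrite !mxE /line !hornerE; ring. Qed.

Lemma line_norm n (y0 y z : 'rV[R]_n) (r t : R) : `|y0 - z| < r -> `|y - z| < r ->
  0 <= t <= 1 -> `|y0 + t *: (y - y0) - z| < r.
Proof.
move=> h0 h1 /andP[t0 t1].
have -> : y0 + t *: (y - y0) - z = (1 - t) *: (y0 - z) + t *: (y - z).
  by apply/rowP => i; rewrite !mxE; ring.
apply: le_lt_trans (ler_normD _ _) _; rewrite !normrZ (ger0_norm t0).
rewrite ger0_norm ?subr_ge0//.
pose s := Num.max `|y0 - z| `|y - z|.
apply: (@le_lt_trans _ _ s); last by rewrite gt_max h0.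
have a : (1 - t) * `|y0 - z| <= (1 - t) * s.
  by apply: ler_wpM2l; rewrite ?subr_ge0// le_max lexx.
have b : t * `|y - z| <= t * s by apply: ler_wpM2l => //; rewrite le_max lexx orbT.
lra.
Qed.

Lemma line_near n (y0 y : 'rV[R]_n) (r : R) : 0 < r ->
  exists2 e, 0 < e & forall t, `|t| < e -> `|y0 + t *: (y - y0) - y0| < r.
Proof.
move=> r0; exists (r / (`|y - y0| + 1)).
  by rewrite divr_gt0// ltr_wpDl.
move=> t; rewrite ltr_pdivlMr ?ltr_wpDl// => H.
rewrite addrAC subrr add0r normrZ; apply: le_lt_trans H.
by apply: ler_wpM2l => //; lra.
Qed.

(** Analyticity is assumed along the segment, because that is what is known of [F] on
the interior of [X]. *)
Lemma line_identity n (F G : 'rV[R]_n -> R) (y0 y : 'rV[R]_n) :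
  (forall t, 0 <= t <= 1 -> expandable (fun t => F (y0 + t *: (y - y0))) t) ->
  (forall t, 0 <= t <= 1 -> expandable (fun t => G (y0 + t *: (y - y0))) t) ->
  (\forall x \near y0, F x = G x) -> F y = G y.
Proof.
move=> hF hG /near_ball_elim[r r0 Hr].
pose D t := F (y0 + t *: (y - y0)) - G (y0 + t *: (y - y0)).
have : D 1 = 0.
  apply: (@expandable_identity R D 1); last by rewrite ler01 lexx.
    by move=> t t01; apply: expandableB; [exact: hF|exact: hG].
  have [e e0 He] := line_near y0 y r0.
  by exists e => // t te; rewrite /D Hr ?subrr//; exact: He.
rewrite /D scale1r (_ : y0 + (y - y0) = y); last by rewrite addrC subrK.
by move/eqP; rewrite subr_eq0 => /eqP.
Qed.

Lemma analytic_line n (F : 'rV[R]_n -> R) (y0 y : 'rV[R]_n) (t : R) :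
  analytic_at F (y0 + t *: (y - y0)) -> expandable (fun t => F (y0 + t *: (y - y0))) t.
Proof.
rewrite -lineE => /analytic_curve; congr expandable.
by apply/funext => s; rewrite lineE.
Qed.

Lemma arc_line n (X : set 'rV[R]_n) (F : 'rV[R]_n -> R) (y0 y : 'rV[R]_n) (t : R) :
  arc_analytic X F -> interior X (y0 + t *: (y - y0)) ->
  expandable (fun t => F (y0 + t *: (y - y0))) t.
Proof.
move=> aF /near_ball_elim[r r0 Hr].
have : expandable (fun t => F (polycurve (line y0 y) t)) t.
  apply: aF; exists (r / (`|y - y0| + 1)); first by rewrite divr_gt0// ltr_wpDl.
  move=> s; rewrite ltr_pdivlMr ?ltr_wpDl// => H; rewrite lineE; apply: Hr.
  have -> : y0 + s *: (y - y0) - (y0 + t *: (y - y0)) = (s - t) *: (y - y0).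
    by apply/rowP => i; rewrite !mxE; ring.
  by rewrite normrZ; apply: le_lt_trans H; apply: ler_wpM2l => //; lra.
by congr expandable; apply/funext => s; rewrite lineE.
Qed.

Lemma near_cont_eq n (F G : 'rV[R]_n -> R) (x : 'rV[R]_n) :
  {for x, continuous F} -> {for x, continuous G} ->
  (forall e, 0 < e -> exists2 y, `|y - x| < e & F y = G y) -> F x = G x.
Proof.
move=> cF cG H; apply/eqP; rewrite -subr_eq0 -normr_le0; apply/ler_addgt0Pr => e e0.
rewrite add0r.
have e2 : 0 < e / 2 by rewrite divr_gt0.
have [d d0 Hd] := continuous_eps cF e2; have [d' d'0 Hd'] := continuous_eps cG e2.
have [|y] := H (Num.min d d'); first by rewrite lt_min d0.
rewrite lt_min => /andP[/Hd h1 /Hd' h2] E; rewrite E in h1.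
have -> : F x - G x = (G y - G x) - (G y - F x) by ring.
by apply: le_trans (ler_normB _ _) _; lra.
Qed.

(** The axis of the cusp enters the interior immediately. *)
Lemma cusp_dense n (X : set 'rV[R]_n) z H m M (e : R) : cusp_at X z H m M -> 0 < e ->
  exists t, [/\ 0 < t, t < e, t < 1 &
    `|polycurve H t - z| < e /\ interior X (polycurve H t)].
Proof.
move=> [m0 M0 H0 Xz HX] e0; have [L L0 HL] := cusp_arc_le m0 H0 M0.
pose t := Num.min 1 (Num.min e (e / L)) / 2.
have t0 : 0 < t by rewrite divr_gt0// !lt_min ltr01 e0 divr_gt0.
have : t < Num.min 1 (Num.min e (e / L)) by move: t0; rewrite /t; lra.
rewrite !lt_min => /and3P[t1 te tL].
have n0 : `|(0 : 'rV[R]_n)| < M by rewrite normr0.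
exists t; split => //.
have := HL 0 t n0; have := HX t 0; rewrite scaler0 addr0 (gtr0_norm t0) => hx hl; split.
  by apply: le_lt_trans (hl (ltW t1)) _; rewrite mulrC -ltr_pdivlMr.
by apply: hx => //; exact: ltW.
Qed.

(** The set [S] of points near which [F] and the sum [T] of the Taylor series agree is
met by the axis of the cusp and is closed in [W `&` interior X] by the identity
theorem on balls, so it contains this connected set; the other points of [X]
are reached by continuity. *)
Lemma local_extension n (X U : set 'rV[R]_n) (F : 'rV[R]_n -> R) z :
  open U -> X `<=` U -> smooth_on U F -> arc_analytic X F ->
  (forall x, X x -> exists H m M, cusp_at X x H m M) -> X z ->
  (forall V, nbhs z V -> exists W,
    [/\ nbhs z W, W `<=` V & connected (W `&` interior X)]) ->
  exists T (r : R), [/\ 0 < r, forall x, `|x - z| < r -> analytic_at T x &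
     forall x, X x -> `|x - z| < r -> F x = T x].
Proof.
move=> oU XU sF aF cX Xz bz.
have [H [m [M cz]]] := cX z Xz.
have [K [C gT]] := taylor_geom_bounded oU XU sF aF cz; have [K0 C0 _] := gT.
pose T x := powsum (taylor_coef F z) (x - z).
have [d d0 Hd] := cusp_agree oU XU sF aF cz gT.
have C'0 : 0 < C^-1 by rewrite invr_gt0.
have aT x : `|x - z| < C^-1 -> analytic_at T x.
  by move=> xz; apply: (powsum_analytic_at gT); rewrite mulrC -ltr_pdivlMr// mul1r.
have [|W [Wz WC cW]] := bz [set x | `|x - z| < C^-1].
  by apply: (near_ball_intro C'0).
pose S : set 'rV[R]_n := [set x : 'rV[R]_n | \forall y \near x, F y = T y].
have oS : open S by rewrite openE => x Sx; exact: near_join Sx.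
have WS : W `&` interior X `<=` S.
  suff <- : (W `&` interior X) `&` S = W `&` interior X by move=> x [].
  apply: cW; last 1 first.
  - exists (closure S); first exact: closed_closure.
    apply/seteqP; split=> [x [Wx Sx]|x [[Wx Xx] Sx]]; split=> //.
      exact: subset_closure.
    (* A ball around [x] on which both functions are analytic along segments. *)
    have nx : nbhs x (interior X `&` [set y | `|y - z| < C^-1]).
      apply: filterI; first exact: nbhs_interior.
      have xC : 0 < C^-1 - `|x - z| by rewrite subr_gt0; exact: WC.
      apply: (near_ball_intro xC) => y yx.
      apply: (le_lt_trans (ler_distD x _ _)); lra.
    have [r r0 Hr] := near_ball_elim nx.
    (* Start the segments at a point of [S] in this ball. *)
    have [y0 [Sy0 y0x]] := Sx _ (nbhsx_ballx x r r0).
    have {}y0x : `|y0 - x| < r by move: y0x; rewrite -ball_normE /= distrC.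
    apply: (near_ball_intro r0) => y yx.
    have Hl t : 0 <= t <= 1 -> `|y0 + t *: (y - y0) - x| < r by exact: line_norm.
    apply: (@line_identity n F T y0 y) => //.
    + by move=> t /Hl /Hr[Xt _]; exact: arc_line aF Xt.
    + by move=> t /Hl /Hr[_ zt]; apply: analytic_line; exact: aT.
  - have [w w0 Hw] := near_ball_elim Wz.
    have [|t [t0 tw t1 [tz Xt]]] := cusp_dense cz (e := Num.min w d).
      by rewrite lt_min w0.
    move: tw tz; rewrite !lt_min => /andP[_ td] /andP[tz _].
    exists (polycurve H t); split; first by split=> //; exact: Hw.
    have [_ M0 _ _ _] := cz; have tm : 0 < t ^+ m by rewrite exprn_gt0.
    apply: (@near_ball_intro _ _ _ (t ^+ m * M)); first by rewrite mulr_gt0.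
    move=> y yp; pose v := (t ^+ m)^-1 *: (y - polycurve H t).
    have yE : y = polycurve H t + t ^+ m *: v.
      by rewrite /v scalerA divff ?gt_eqF// scale1r addrC subrK.
    rewrite /T yE; apply: Hd; first by rewrite (ltW t0) ltW.
    by rewrite normrZ normfV (gtr0_norm tm) ltr_pdivrMl.
  - by exists S.
have [w w0 Hw] := near_ball_elim
  (filterI Wz (near_ball_intro (P := fun x => `|x - z| < C^-1) C'0 (fun _ => id))).
exists T, w; split=> //.
  by move=> x /Hw[_]; exact: aT.
move=> x Xx xz.
apply: near_cont_eq.
- by have [] := sF [::] x (XU _ Xx).
- by apply: analytic_continuous; apply: aT; have [] := Hw x xz.
move=> e e0; have [Hx [mx [Mx cx]]] := cX x Xx.
have [|t [t0 te t1 [tx Xt]]] := cusp_dense cx (e := Num.min e (w - `|x - z|)).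
  by rewrite lt_min e0 subr_gt0.
exists (polycurve Hx t); first by move: tx; rewrite lt_min => /andP[].
apply: (@nbhs_singleton _ _ [set y | F y = T y]).
apply: WS; split => //.
apply: (Hw _ _).1.
apply: (le_lt_trans (ler_distD x _ _)).
by move: tx; rewrite lt_min => /andP[_]; lra.
Qed.

Lemma ball_connected n (z : 'rV[R]_n) (r : R) : 0 < r -> connected (ball z r).
Proof.
move=> r0.
pose seg y := (fun t : R => z + t *: (y - z)) @` `[0, 1]%classic.
have inb y t : `|y - z| < r -> 0 <= t <= 1 -> ball z r (z + t *: (y - z)).
  move=> yz t01; rewrite -ball_normE /= distrC; apply: line_norm => //.
  by rewrite subrr normr0.
have -> : ball z r = \bigcup_(y in [set y | `|y - z| < r]) seg y.
  apply/seteqP; split=> [y|y [x xz [t]]].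
    rewrite -ball_normE /= distrC => yz; exists y => //; exists 1.
      by rewrite /= in_itv /= ler01 lexx.
    by rewrite scale1r addrC subrK.
  by rewrite /= in_itv /= => t01 <-; exact: inb.
apply: bigcup_connected.
  exists z => y _; exists 0; first by rewrite /= in_itv /= ler01 lexx.
  by rewrite scale0r addr0.
move=> y _; apply: connected_continuous_connected; first exact: segment_connected.
apply: continuous_subspaceT => t.
apply: cvgD; first exact: cvg_cst.
by apply: cvgZl; exact: cvg_id.
Qed.

(** Where two quarter-balls meet, the larger ball contains the centre of the smaller
one.  Near that centre there are interior points of [X], where both extensions
equal [F], and the intersection of the two balls is convex. *)
Lemma glue n (X : set 'rV[R]_n) (F : 'rV[R]_n -> R) (f : X -> R) :
  (forall x : X, F (\val x) = f x) ->
  (forall x, X x -> forall e : R, 0 < e -> exists2 y, `|y - x| < e & interior X y) ->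
  (forall z, X z -> exists T (r : R), [/\ 0 < r, forall x, `|x - z| < r -> analytic_at T x &
     forall x, X x -> `|x - z| < r -> F x = T x]) ->
  analytic_restr X f.
Proof.
move=> Ff dX loc.
have /choice[T /choice[r Hr]] (z : 'rV[R]_n) : exists T, exists r : R, X z ->
    [/\ 0 < r, forall x, `|x - z| < r -> analytic_at T x &
     forall x, X x -> `|x - z| < r -> F x = T x].
  have [Xz|nX] := pselect (X z); last by exists F, 0.
  by have [T [r ?]] := loc z Xz; exists T, r.
have agree z0 z1 y : X z0 -> X z1 -> `|y - z0| < r z0 / 4 -> `|y - z1| < r z1 / 4 ->
    T z0 y = T z1 y.
  have key u0 u1 : X u0 -> X u1 -> `|y - u0| < r u0 / 4 -> `|y - u1| < r u1 / 4 ->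
      r u1 <= r u0 -> T u0 y = T u1 y.
    move=> X0 X1 y0 y1 r10.
    have [r00 a0 h0] := Hr u0 X0; have [r01 a1 h1] := Hr u1 X1.
    have u10 : `|u1 - u0| < r u0 / 2.
      apply: (le_lt_trans (ler_distD y _ _)).
      by rewrite distrC in y1; lra.
    have [|x xz Xx] := dX u1 X1 (r u1 / 4); first by rewrite divr_gt0.
    have xz0 : `|x - u0| < r u0.
      apply: (le_lt_trans (ler_distD u1 _ _)); lra.
    apply: (@line_identity n (T u0) (T u1) x y).
    - move=> t t01; apply: analytic_line; apply: a0; apply: line_norm => //; lra.
    - move=> t t01; apply: analytic_line; apply: a1; apply: line_norm => //; lra.
    have [d d0 Hd] := near_ball_elim Xx.
    pose d' := Num.min d (Num.min (r u0 - `|x - u0|) (r u1 - `|x - u1|)).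
    have d'0 : 0 < d' by rewrite !lt_min d0 !subr_gt0 xz0 /=; lra.
    apply: (near_ball_intro d'0) => w; rewrite !lt_min => /and3P[w1 w2 w3].
    rewrite -h0; last 2 first.
    - exact: Hd.
    - apply: (le_lt_trans (ler_distD x _ _)); lra.
    apply: h1; first exact: Hd.
    apply: (le_lt_trans (ler_distD x _ _)); lra.
  move=> X0 X1 y0 y1; have [le|/ltW le] := leP (r z1) (r z0); first exact: key.
  by apply/esym; apply: key.
pose near_pt y z := X z /\ `|y - z| < r z / 4.
pose zz y := xget 0 (near_pt y).
pose V := \bigcup_(z in X) [set y | `|y - z| < r z / 4].
have zzP y : V y -> near_pt y (zz y).
  by move=> [z Xz yz]; apply: (@xgetPex _ 0 (near_pt y)); exists z.
have oV : open V.
  apply: bigcup_open => z Xz; rewrite openE => y /= yz.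
  have p : 0 < r z / 4 - `|y - z| by rewrite subr_gt0.
  apply: (near_ball_intro p) => w wy.
  apply: (le_lt_trans (ler_distD y _ _)); lra.
exists V, (fun y => T (zz y) y); split=> //.
- move=> z Xz; have [r0 _ _] := Hr z Xz; exists z => //.
  by rewrite /= subrr normr0 divr_gt0.
- move=> y Vy; have [Xz yz] := zzP y Vy.
  have [r0 a0 _] := Hr _ Xz.
  have /analytic_atP[c [K [C [g Hc]]]] : analytic_at (T (zz y)) y by apply: a0; lra.
  apply/analytic_atP; exists c, K, C; split=> //.
  have p : 0 < r (zz y) / 4 - `|y - zz y| by rewrite subr_gt0.
  have nV : \forall w \near y, V w by exact: open_nbhs_nbhs.
  have nz : \forall w \near y, `|w - zz y| < r (zz y) / 4.
    apply: (near_ball_intro p) => w wy.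
    apply: (le_lt_trans (ler_distD y _ _)); lra.
  near=> w.
  have Vw : V w by near: w.
  have [Xzw wzw] := zzP w Vw.
  rewrite -(agree (zz y) (zz w) w) //; first by near: w.
  by near: w.
- move=> x.
  have Xx : X (\val x) by exact: set_valP.
  have Vx : V (\val x).
    have [r0 _ _] := Hr _ Xx; exists (\val x) => //.
    by rewrite /= subrr normr0 divr_gt0.
  have [Xz xz] := zzP _ Vx; have [r0 _ h0] := Hr _ Xz.
  by rewrite -h0//; lra.
Unshelve. all: by end_near. Qed.

End Extension.

Theorem corollary1p2 (R : realType) (n : nat) (X : set 'rV[R]_n)
  (X_neq0 : X !=set0) (X_closed : closed X) (X_simple : simple_set X)
  (X_UPC : forall z : 'rV[R]_n, boundary X z ->
     exists Xz : set 'rV[R]_n, [/\ UPC Xz, Xz z & Xz `<=` X]) :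
  Comega 1 X `&` smooth_restr X = analytic_restr X.
Proof.
have bd z : X z -> ~ interior X z -> boundary X z.
  by move=> Xz nX; split=> //; exact: subset_closure.
apply/seteqP; split=> [f [Cf [U [F [oU XU sF Ff]]]]|f [U [F [oU XU aF Ff]]]].
  have aF := Comega_arc_analytic Cf Ff.
  have cX x : X x -> exists H m M, cusp_at X x H m M.
    move=> Xx; have [iX|nX] := pselect (interior X x); first exact: cusp_interior.
    have [Y [uY Yx YX]] := X_UPC x (bd x Xx nX).
    exact: cusp_UPC uY Yx YX.
  apply: (glue Ff) => [x Xx e e0|z Xz].
    have [H [m [M cx]]] := cX x Xx.
    by have [t [_ _ _ [tx Xt]]] := cusp_dense cx e0; exists (polycurve H t).
  apply: (local_extension oU XU sF aF cX Xz) => V Vz.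
  have [iX|nX] := pselect (interior X z).
    have [r r0 Hr] := near_ball_elim (filterI Vz (nbhs_interior iX)).
    exists (ball z r); split; first exact: nbhsx_ballx.
      by move=> y; rewrite -ball_normE /= distrC => /Hr[].
    rewrite (_ : _ `&` _ = ball z r).
      exact: ball_connected.
    apply/seteqP; split=> [y []//|y By]; split=> //.
    by move: By; rewrite -ball_normE /= distrC => /Hr[].
  have [B [Bn Bb Bc]] := X_simple z (bd z Xz nX).
  have [W BW WV] := Bb V Vz.
  by exists W; split=> //; [exact: Bn|exact: Bc].
split; last first.
  by exists U, F; split=> //; exact: analytic_smooth.
move=> d _ p [_ pX]; exists (fun t => F (polymap p t)); split.
  apply: analytic_at_comp; apply: aF; apply: XU.
  exact: (nbhs_singleton pX).
by apply: filterE => t x xE; rewrite -Ff xE.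
Qed.
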